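(* Let $X$ be a complex Banach space and let $\mathcal F \subseteq \mathcal B(X)$ be an L-nilpotent family of polynomially compact operators on $X$. Then the family $\mathcal F$ is triangularizable.
   Context: $\mathcal B(X)$ denotes the Banach algebra of all bounded linear operators on $X$. An operator $T \in \mathcal B(X)$ is polynomially compact if there is a nonzero complex polynomial $p$ such that $p(T)$ is a compact operator. Write $[A,B]=AB-BA$. For a family $\mathcal F$ of operators put $\mathcal F^{[0]}=\mathcal F$ and $\mathcal F^{[k]}=\{[A,B] : A\in \mathcal F^{[k-1]},\ B\in\mathcal F\}$ for $k=1,2,\ldots$. The family $\mathcal F$ is L-nilpotent if $\mathcal F^{[k]}=\{0\}$ for some $k\in\mathbb N$. A family of bounded operators on a Banach space $X$ is triangularizable if there is a chain (a set totally ordered by inclusion) of closed subspaces of $X$, each invariant under every member of the family, which is maximal as a chain in the lattice of all closed subspaces of $X$. *)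

(* Defs.v *)
From mathcomp Require Import all_boot all_order all_algebra.
From mathcomp Require Import complex.
From mathcomp Require Import all_classical all_reals.
From mathcomp Require Import topology normedtype.

Set Implicit Arguments.
Unset Strict Implicit.
Unset Printing Implicit Defensive.

Import Order.TTheory GRing.Theory Num.Theory.
Import numFieldNormedType.Exports.

Local Open Scope classical_set_scope.
Local Open Scope ring_scope.
Local Open Scope complex_scope.

Section Operators.
Context {R : realType} {X : completeNormedModType R[i]}.

(* The elements of B(X) are handled as plain functions, so that the vector
   space operations on them are those of the function space X -> X. *)
Definition bounded_operator (T : X -> X) : Prop :=
  linear T /\ bounded_near T (nbhs (0 : X)).

Definition compact_operator (T : X -> X) : Prop :=
  bounded_operator T /\ compact (closure (T @` [set x | `|x| <= 1])).

(* p(T), where T ^ i is the i-fold composition iter i T *)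
Definition poly_operator (p : {poly R[i]}) (T : X -> X) : X -> X :=
  \sum_(i < size p) p`_i *: iter i T.

Definition polynomially_compact (T : X -> X) : Prop :=
  bounded_operator T /\
  exists2 p : {poly R[i]}, p != 0 & compact_operator (poly_operator p T).

Definition commutator (A B : X -> X) : X -> X := (A \o B) - (B \o A).

Fixpoint iter_commutators (F : set (X -> X)) (k : nat) : set (X -> X) :=
  if k is k'.+1
  then [set commutator A B | A in iter_commutators F k' & B in F]
  else F.

Definition L_nilpotent (F : set (X -> X)) : Prop :=
  exists k : nat, iter_commutators F k = [set 0].

Definition closed_subspace (M : set X) : Prop :=
  [/\ closed M, M 0 & forall (a : R[i]) x y, M x -> M y -> M (a *: x + y)].

Definition subspace_chain (C : set (set X)) : Prop :=
  C `<=` closed_subspace /\ total_on C subset.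

Definition maximal_subspace_chain (C : set (set X)) : Prop :=
  subspace_chain C /\
  forall D : set (set X), subspace_chain D -> C `<=` D -> D = C.

Definition invariant_subspace (T : X -> X) (M : set X) : Prop :=
  T @` M `<=` M.

Definition triangularizable (F : set (X -> X)) : Prop :=
  exists2 C : set (set X), maximal_subspace_chain C &
    forall M, C M -> forall T, F T -> invariant_subspace T M.

End Operators.

(* Main.v *)
Require Import Defs.
From HB Require Import structures.
From mathcomp Require Import all_boot all_order all_algebra.
From mathcomp Require Import complex cyclic separable cyclotomic.
From mathcomp Require Import all_classical all_reals.
From mathcomp Require Import topology normedtype.
From mathcomp Require Import ssrAC ring lra zify.

Set Implicit Arguments.
Unset Strict Implicit.
Unset Printing Implicit Defensive.

Import Order.TTheory GRing.Theory Num.Theory.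
Import numFieldNormedType.Exports.

Local Open Scope classical_set_scope.
Local Open Scope ring_scope.
Local Open Scope complex_scope.

(** A chain of closed invariant subspaces that is maximal among such chains,
    given by Zorn's lemma, turns out to be maximal among all chains of closed
    subspaces. For suppose that a closed subspace [L] is comparable with every
    member of the chain. Let [N] be the closed union of the members inside [L], and
    [M] the intersection of those around [L]. Both are invariant. If [L] lay
    strictly between them, then [M / N] would contain a nontrivial closed
    subspace, and some invariant closed subspace strictly between [N] and [M]
    ([subquotient_invariant_subspace]) could be added to the chain. Hence [L] is
    [N] or [M], so it is invariant and belongs to the chain.

    The operators induced on [M / N] again form a nilpotent family of polynomially
    compact operators, so everything rests on the existence of a nontrivial
    closed invariant subspace for such a family on a normed space that has a
    nontrivial closed subspace at all ([nilpotent_invariant_subspace]). The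
    members of the last nonzero level of iterated commutators commute with the
    whole family. Hence, unless the family consists of scalars, it is enough to
    find among them a nonscalar polynomially compact operator, and to know that
    such an operator has a hyperinvariant subspace.

    If that level is the family itself, it consists of polynomially compact
    operators. Otherwise a nonzero member is a commutator [C] of some [A] with an
    element [B] of the family, and [C] commutes with [A] and [B]. By the
    Wintner-Wielandt theorem ([comm_op_scalar_eq0]) [C] is not a scalar. If [p]
    has degree [n] and [p(B)] is compact, bracketing [n] times with [A], which acts
    as a derivation, turns [p(B)] into [n! * lead_coef p * C ^ n], so that [C ^ n]
    is compact ([compact_iter_comm_op]).

    A nonscalar operator [T] with [p(T)] compact has a hyperinvariant subspace
    ([polynomially_compact_hyperinvariant]): an eigenspace if [T] has an
    eigenvalue. If not, [K = T p(T)] is compact and has no eigenvalue either, the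
    scalars being algebraically closed. Such a [K] is quasinilpotent
    ([compact_op_quasinilpotent]): compactness bounds [K - a] from below uniformly
    on annuli around 0, and Cauchy's estimate for the square of the resolvent
    turns this into a decrease of the growth rate of the powers of [K]. Hilden's
    version of Lomonosov's argument then applies to [K]
    ([quasinilpotent_hyperinvariant]). *)

(** * The real-valued norm *)

Section RealNorm.
Context {R : realType}.

(** The norm of a complex normed space takes its values in the partially
    ordered field [R[i]]; all estimates below are made with its real part, so
    that they live in a totally ordered archimedean field. *)
Definition nrm {V : normedZmodType R[i]} (x : V) : R := complex.Re `|x|.

Section Zmodule.
Context {V : normedZmodType R[i]}.
Implicit Types x y z : V.

Lemma nrmE x : `|x| = (nrm x)%:C.
Proof. by rewrite /nrm RRe_real // normr_real. Qed.

Lemma nrm_ge0 x : 0 <= nrm x.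
Proof. by rewrite -ler0c -nrmE. Qed.

Lemma nrm0 : nrm (0 : V) = 0.
Proof. by rewrite /nrm normr0. Qed.

Lemma nrm_eq0 x : (nrm x == 0) = (x == 0).
Proof. by rewrite -[RHS]normr_eq0 nrmE -(inj_eq (@complexI R)). Qed.

Lemma nrm_gt0 x : (0 < nrm x) = (x != 0).
Proof. by rewrite lt0r nrm_ge0 andbT nrm_eq0. Qed.

Lemma nrmD x y : nrm (x + y) <= nrm x + nrm y.
Proof. by rewrite -lecR rmorphD /= -!nrmE ler_normD. Qed.

Lemma nrmN x : nrm (- x) = nrm x.
Proof. by rewrite /nrm normrN. Qed.

Lemma nrmB x y : nrm (x - y) = nrm (y - x).
Proof. by rewrite -nrmN opprB. Qed.

Lemma nrm_sub_le x y : nrm (x - y) <= nrm x + nrm y.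
Proof. by rewrite -(nrmN y) nrmD. Qed.

Lemma nrm_le_sub x y : nrm x - nrm y <= nrm (x - y).
Proof. by rewrite lerBlDr -{1}(subrK y x) nrmD. Qed.

Lemma nrm_sum n (F : 'I_n -> V) : nrm (\sum_(i < n) F i) <= \sum_(i < n) nrm (F i).
Proof.
elim/big_ind2 : _ => //; first by rewrite nrm0.
by move=> x a y b xa yb; apply: le_trans (nrmD _ _) (lerD xa yb).
Qed.

End Zmodule.

Lemma nrm_real (t : R) : nrm (t%:C : R[i]) = `|t|.
Proof. by rewrite /nrm normc_def /= expr0n /= addr0 sqrtr_sqr. Qed.

Lemma nrmM (a b : R[i]) : nrm (a * b) = nrm a * nrm b.
Proof. by apply: complexI; rewrite rmorphM /= -!nrmE normrM. Qed.

Lemma nrm1 : nrm (1 : R[i]) = 1.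
Proof. by rewrite -[1]/(1%:C) nrm_real normr1. Qed.

Lemma nrmX (a : R[i]) n : nrm (a ^+ n) = nrm a ^+ n.
Proof. by elim: n => [|n IH]; rewrite ?expr0 ?nrm1 // !exprS nrmM IH. Qed.

Lemma nrmV (a : R[i]) : nrm a^-1 = (nrm a)^-1.
Proof. by apply: complexI; rewrite fmorphV /= -!nrmE normfV. Qed.

Lemma nrm_nat n : nrm (n%:R : R[i]) = n%:R.
Proof. by rewrite -(rmorph_nat (real_complex R)) nrm_real normr_nat. Qed.

Section Topology.
Context {V : normedModType R[i]}.
Implicit Types (x y : V) (A : set V).

Lemma nrmZ (a : R[i]) x : nrm (a *: x) = nrm a * nrm x.
Proof. by apply: complexI; rewrite rmorphM /= -!nrmE normrZ. Qed.

Lemma nrmZr (t : R) x : nrm (t%:C *: x) = `|t| * nrm x.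
Proof. by rewrite nrmZ nrm_real. Qed.

Lemma nbhs_nrmP x A :
  nbhs x A <-> exists2 e : R, 0 < e & forall y, nrm (x - y) < e -> A y.
Proof.
split.
- move/nbhs_normP => [e /= e0 xA]; exists (complex.Re e).
    by move: e0; rewrite ltcE /= => /andP[].
  move=> y xy; apply: xA => /=; rewrite nrmE.
  by rewrite -[e]RRe_real ?gtr0_real // ltcR.
- move=> [e e0 xA]; apply/nbhs_normP; exists e%:C; rewrite /= ?ltcR //.
  by move=> y /=; rewrite nrmE ltcR; apply: xA.
Qed.

Lemma closure_nrmP A x :
  closure A x <-> forall e : R, 0 < e -> exists2 y, A y & nrm (x - y) < e.
Proof.
split=> [Ax e e0|Ax B /nbhs_nrmP[e e0 xB]].
  have /Ax[y [Ay xy]] : nbhs x [set y | nrm (x - y) < e].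
    by apply/nbhs_nrmP; exists e.
  by exists y.
by have [y Ay xy] := Ax _ e0; exists y; split=> //; apply: xB.
Qed.

Lemma closed_nrmP A :
  closed A <-> forall x, (forall e : R, 0 < e ->
    exists2 y, A y & nrm (x - y) < e) -> A x.
Proof.
split=> [cA x Ax|cA x Ax]; first by apply: cA; apply/closure_nrmP.
by apply: cA; apply/closure_nrmP.
Qed.

End Topology.

Lemma open_nrm_lt {V W : normedModType R[i]} (f : V -> W) (c : R) :
  continuous f -> open [set x | nrm (f x) < c].
Proof.
move=> cf; rewrite openE => x /= fxc.
have c0 : 0 < c - nrm (f x) by rewrite subr_gt0.
have : nbhs (f x) [set y | nrm y < c].
  apply/nbhs_nrmP; exists (c - nrm (f x)) => // y; rewrite nrmB => h.
  by have := nrm_le_sub y (f x); rewrite /=; lra.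
by move/cf.
Qed.

Lemma lipschitz_continuous {V W : normedModType R[i]} (f : V -> W) (c : R) :
  (forall x y, nrm (f x - f y) <= c * nrm (x - y)) -> continuous f.
Proof.
move=> fc x A /nbhs_nrmP[e e0 eA]; apply/nbhs_nrmP.
have c0 : 0 < `|c| + 1 by rewrite ltr_wpDl.
exists (e / (`|c| + 1)) => [|y xy]; first by rewrite divr_gt0.
apply: eA; apply: le_lt_trans (fc _ _) _.
apply: (@le_lt_trans _ _ ((`|c| + 1) * nrm (x - y))).
  by apply: ler_wpM2r; [exact: nrm_ge0|have := ler_norm c; lra].
by move: xy; rewrite ltr_pdivlMr // mulrC.
Qed.

Lemma nrm_continuous {V : normedModType R[i]} : continuous (@nrm V).
Proof.
move=> x A /nbhs_ballP[e /= e0 eA]; apply/nbhs_nrmP; exists e => // y xy.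
apply: eA; rewrite /ball /= real_ltr_norml ?num_real //.
have := nrm_le_sub x y; have := nrm_le_sub y x; rewrite nrmB.
by move=> h1 h2; apply/andP; split; lra.
Qed.

Lemma compact_nrm_bounded {V : normedModType R[i]} (D : set V) : compact D ->
  exists2 c : R, 0 <= c & forall y, D y -> nrm y <= c.
Proof.
move=> cD; have /compact_bounded[M [_ DM]] : compact (@nrm V @` D).
  by apply: continuous_compact cD; exact/continuous_subspaceT/nrm_continuous.
exists (`|M| + 1) => [|y Dy]; first by rewrite addr_ge0.
apply: le_trans (ler_norm _) (DM (`|M| + 1) _ _ _); last by exists y.
by have := ler_norm M; lra.
Qed.

End RealNorm.

(** * Bounded and compact operators on a normed space *)

Section LinearMaps.
Context {K : pzRingType} {V W : lmodType K} {T : V -> W} (lT : linear T).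

Let L : {linear V -> W} := HB.pack T (GRing.isLinear.Build K V W *:%R T lT).

Lemma lin0 : T 0 = 0. Proof. exact: (linear0 L). Qed.
Lemma linD x y : T (x + y) = T x + T y. Proof. exact: (linearD L). Qed.
Lemma linB x y : T (x - y) = T x - T y. Proof. exact: (linearB L). Qed.
Lemma linZ a x : T (a *: x) = a *: T x. Proof. exact: (linearZ_LR L). Qed.
Lemma lin_sum I (r : seq I) (P : pred I) (E : I -> V) :
  T (\sum_(i <- r | P i) E i) = \sum_(i <- r | P i) T (E i).
Proof. exact: (linear_sum L). Qed.

End LinearMaps.

Lemma linear_iter {K : pzRingType} {V : lmodType K} (T : V -> V) n :
  linear T -> linear (iter n T).
Proof. by move=> lT; elim: n => [|n IH] a x y //=; rewrite IH lT. Qed.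

Lemma iter_comm {V : Type} (S T : V -> V) n :
  (forall x, S (T x) = T (S x)) -> forall x, S (iter n T x) = iter n T (S x).
Proof. by move=> ST x; elim: n => //= n IH; rewrite ST IH. Qed.

Section Operators.
Context {R : realType} {V : normedModType R[i]}.
Implicit Types (S T K : V -> V) (x y : V).

Definition bounded_op T :=
  linear T /\ exists2 c : R, 0 <= c & forall x, nrm (T x) <= c * nrm x.

(** Asking only for some compact set that contains the image of the unit ball,
    instead of compactness of the closure of that image, makes the stability
    properties immediate. *)
Definition compact_op K :=
  linear K /\ exists2 D : set V, compact D & forall x, nrm x <= 1 -> D (K x).

Lemma bounded_op_gt0 T : bounded_op T ->
  exists2 c : R, 0 < c & forall x, nrm (T x) <= c * nrm x.
Proof.
move=> [_ [c c0 Tc]]; exists (c + 1) => [|x]; first by rewrite ltr_wpDl.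
by apply: le_trans (Tc x) _; rewrite ler_wpM2r ?nrm_ge0 // lerDl.
Qed.

Lemma bounded_op_continuous T : bounded_op T -> continuous T.
Proof.
move=> [lT [c _ Tc]]; apply: (@lipschitz_continuous _ _ _ _ c) => x y.
by rewrite -linB.
Qed.

Lemma bounded_op_id : bounded_op id.
Proof. by split=> //; exists 1 => // x; rewrite mul1r. Qed.

Lemma bounded_op_comp S T : bounded_op S -> bounded_op T -> bounded_op (S \o T).
Proof.
move=> [lS [s s0 Ss]] [lT [t t0 Tt]]; split=> [a x y|]; first by rewrite /= lT lS.
exists (s * t) => [|x]; first exact: mulr_ge0.
by apply: le_trans (Ss _) _; rewrite -mulrA ler_wpM2l.
Qed.

Lemma bounded_op_add S T :
  bounded_op S -> bounded_op T -> bounded_op (fun x => S x + T x).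
Proof.
move=> [lS [s s0 Ss]] [lT [t t0 Tt]]; split=> [a x y|].
  by rewrite /= lT lS scalerDr addrACA.
exists (s + t) => [|x]; first exact: addr_ge0.
by apply: le_trans (nrmD _ _) _; rewrite mulrDl lerD.
Qed.

Lemma bounded_op_scale a : bounded_op (fun x => a *: x).
Proof.
split=> [b x y|]; first by rewrite scalerDr !scalerA mulrC.
by exists (nrm a) => [|x]; rewrite ?nrm_ge0 // nrmZ.
Qed.

Lemma bounded_op_sub S T :
  bounded_op S -> bounded_op T -> bounded_op (fun x => S x - T x).
Proof.
move=> bS bT.
have := bounded_op_add bS (bounded_op_comp (bounded_op_scale (-1)) bT).
by congr bounded_op; apply/funext => x /=; rewrite scaleN1r.
Qed.

Lemma bounded_op_iter T n : bounded_op T -> bounded_op (iter n T).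
Proof.
move=> bT; elim: n => [|n IH]; first exact: bounded_op_id.
exact: bounded_op_comp bT IH.
Qed.

Lemma iter_bound T (c : R) : 0 <= c -> (forall x, nrm (T x) <= c * nrm x) ->
  forall n x, nrm (iter n T x) <= c ^+ n * nrm x.
Proof.
move=> c0 Tc; elim=> [|n IH] x /=; first by rewrite mul1r.
by apply: le_trans (Tc _) _; rewrite exprS -mulrA ler_wpM2l.
Qed.

Lemma compact_opW K : compact_op K -> bounded_op K.
Proof.
move=> [lK [D cD KD]]; split=> //.
have [c c0 Dc] := compact_nrm_bounded cD.
exists c => // x; have [->|x0] := eqVneq x 0; first by rewrite lin0 // nrm0 mulr0.
have nx : 0 < nrm x by rewrite nrm_gt0.
have /KD/Dc : nrm ((nrm x)^-1%:C *: x) <= 1.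
  by rewrite nrmZr ger0_norm ?invr_ge0 ?nrm_ge0 // mulVf // gt_eqF.
rewrite linZ // nrmZr ger0_norm ?invr_ge0 ?nrm_ge0 //.
by rewrite mulrC ler_pdivrMr.
Qed.

Lemma compact_op_compl S K : bounded_op S -> compact_op K -> compact_op (S \o K).
Proof.
move=> bS [lK [D cD KD]]; split=> [a x y|]; first by rewrite /= lK bS.1.
exists (S @` D) => [|x x1]; last by exists (K x); [exact: KD|].
apply: continuous_compact cD; apply: continuous_subspaceT.
exact: bounded_op_continuous.
Qed.

Lemma compact_op_scale a K : compact_op K -> compact_op (fun x => a *: K x).
Proof. exact/compact_op_compl/bounded_op_scale. Qed.

Lemma compact_op_compr S K : bounded_op S -> compact_op K -> compact_op (K \o S).
Proof.
move=> bS cK; have [lS _] := bS; have [c c0 Sc] := bounded_op_gt0 bS.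
have [lK [D cD KD]] := cK; split=> [a x y|]; first by rewrite /= lS lK.
exists ((fun y => c%:C *: y) @` D) => [|x x1].
  apply: continuous_compact cD; apply: continuous_subspaceT.
  exact/bounded_op_continuous/bounded_op_scale.
exists (K (c^-1%:C *: S x)).
  apply: KD; rewrite nrmZr ger0_norm ?invr_ge0 ?(ltW c0) //.
  rewrite ler_pdivrMl // mulr1; apply: le_trans (Sc _) _.
  by rewrite ler_piMr // ltW.
rewrite linZ // scalerA -rmorphM /= divff ?gt_eqF // scale1r //.
Qed.

Lemma compact_op_add K1 K2 :
  compact_op K1 -> compact_op K2 -> compact_op (fun x => K1 x + K2 x).
Proof.
move=> [l1 [D1 c1 K1D]] [l2 [D2 c2 K2D]]; split=> [a x y|].
  by rewrite l1 l2 scalerDr addrACA.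
exists ((fun p : V * V => p.1 + p.2) @` (D1 `*` D2)) => [|x x1].
  apply: continuous_compact (compact_setX c1 c2); apply: continuous_subspaceT.
  exact: add_continuous.
by exists (K1 x, K2 x) => //; split; [exact: K1D|exact: K2D].
Qed.

Lemma compact_op_sub K1 K2 :
  compact_op K1 -> compact_op K2 -> compact_op (fun x => K1 x - K2 x).
Proof.
move=> c1 c2; have := compact_op_add c1 (compact_op_scale (-1) c2).
by congr compact_op; apply/funext => x; rewrite scaleN1r.
Qed.

End Operators.

(** * Polynomials in an operator *)

Section PolyOp.
Context {K : nzRingType} {V : lmodType K}.
Implicit Types (S T : V -> V) (p q : {poly K}).

(** [poly_operator], over any module. *)
Definition poly_op p T x := \sum_(i < size p) p`_i *: iter i T x.

Lemma poly_op_wide n p T x : (size p <= n)%N ->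
  poly_op p T x = \sum_(i < n) p`_i *: iter i T x.
Proof.
move=> pn; rewrite /poly_op (big_ord_widen n (fun i => p`_i *: iter i T x)) //.
rewrite big_mkcond; apply: eq_bigr => i _ /=.
by case: ltnP => // /(nth_default 0) ->; rewrite scale0r.
Qed.

Lemma poly_opD p q T x : poly_op (p + q) T x = poly_op p T x + poly_op q T x.
Proof.
rewrite (poly_op_wide T x (size_polyD p q)).
rewrite (poly_op_wide T x (leq_maxl (size p) (size q))).
rewrite (poly_op_wide T x (leq_maxr (size p) (size q))) -big_split /=.
by apply: eq_bigr => i _; rewrite coefD scalerDl.
Qed.

Lemma poly_opZ a p T x : poly_op (a *: p) T x = a *: poly_op p T x.
Proof.
rewrite (poly_op_wide T x (size_scale_leq a p)) scaler_sumr.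
by apply: eq_bigr => i _; rewrite coefZ scalerA.
Qed.

Lemma poly_op_MX p T x : poly_op (p * 'X) T x = poly_op p T (T x).
Proof.
rewrite (@poly_op_wide (size p).+1) ?size_polyMleq //; last first.
  by rewrite (leq_trans (size_polyMleq _ _)) // size_polyX addn2.
rewrite big_ord_recl coefMX eqxx scale0r add0r; apply: eq_bigr => i _.
by rewrite coefMX lift0 iterSr.
Qed.

Lemma poly_opC c T x : poly_op c%:P T x = c *: x.
Proof.
by rewrite (@poly_op_wide 1) ?size_polyC_leq1 // big_ord1 coefC eqxx.
Qed.

Lemma poly_op0 T x : poly_op 0 T x = 0.
Proof. by rewrite -[0]/(0%:P) poly_opC scale0r. Qed.

Lemma poly_opX T x : poly_op 'X T x = T x.
Proof. by rewrite -['X]mul1r poly_op_MX -[1]/(1%:P) poly_opC scale1r. Qed.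

Lemma poly_op_comm S T p : linear S -> (forall x, S (T x) = T (S x)) ->
  forall x, S (poly_op p T x) = poly_op p T (S x).
Proof.
move=> lS ST x; rewrite /poly_op lin_sum //; apply: eq_bigr => i _.
by rewrite linZ // iter_comm.
Qed.

End PolyOp.

Section PolyOpCom.
Context {K : comNzRingType} {V : lmodType K} {T : V -> V} (lT : linear T).
Implicit Types (p q : {poly K}) (x y : V).

Lemma linear_poly_op p : linear (poly_op p T).
Proof.
elim/poly_ind: p => [|p c IH] a x y; first by rewrite !poly_op0 scaler0 addr0.
rewrite !poly_opD !poly_op_MX !poly_opC lT IH !scalerDr !scalerA (mulrC c).
by rewrite addrACA.
Qed.

Lemma poly_opM p q x : poly_op (p * q) T x = poly_op p T (poly_op q T x).
Proof.
elim/poly_ind: p q x => [|p c IH] q x; first by rewrite mul0r !poly_op0.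
rewrite mulrDl -mulrA (mulrC 'X) mulrA mul_polyC !poly_opD !poly_op_MX poly_opZ.
by rewrite poly_opC IH -(poly_op_comm _ lT).
Qed.

End PolyOpCom.

(** * Powers of a compact operator without nonzero eigenvalues *)

Section Disc.
Context {R : realType}.

Lemma real_complex_continuous : continuous (fun t : R => t%:C : R[i]^o).
Proof.
move=> t A /(@nbhs_nrmP R R[i]^o)[e e0 eA]; apply/nbhs_ballP; exists e => // s ts.
by apply: eA; rewrite -rmorphB nrm_real.
Qed.

(** The disc lies in a square, a continuous image of a product of two segments. *)
Lemma disc_sub_compact (B : R) :
  exists2 D : set R[i]^o, compact D & forall z : R[i], nrm z <= B -> D z.
Proof.
pose f (p : R * R) : R[i]^o := p.1%:C + p.2%:C * 'i.
exists (f @` (`[- B, B] `*` `[- B, B])).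
  apply: continuous_compact; last by apply: compact_setX; exact: segment_compact.
  apply: continuous_subspaceT => p; apply: cvgD.
    apply: (@continuous_comp _ _ _ fst (fun t : R => t%:C : R[i]^o)) => //.
      exact: cvg_fst.
    exact: real_complex_continuous.
  apply: cvgMl.
  apply: (@continuous_comp _ _ _ snd (fun t : R => t%:C : R[i]^o)) => //.
    exact: cvg_snd.
  exact: real_complex_continuous.
have Re_le (w : R[i]) : `|complex.Re w| <= nrm w.
  by rewrite -lecR -nrmE normc_ge_Re.
move=> z zB; exists (complex.Re z, complex.Im z); last first.
  by rewrite /f /= [RHS]complexE (mulrC 'i%C).
have := Re_le z; have := Re_le (z * 'i%C).
rewrite ReiNIm normrN nrmM.
have -> : nrm ('i%C : R[i]) = 1.
  by rewrite /nrm normc_def /= expr0n expr1n /= add0r sqrtr1.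
rewrite mulr1 => zI zR; split; rewrite /= in_itv /= -ler_norml.
  exact: le_trans zB.
exact: le_trans zB.
Qed.

End Disc.

Section BoundedBelow.
Context {R : realType} {V : normedModType R[i]}.

(** An almost eigenvector [x] of norm 1 for [a] gives the vector [K x] of a fixed
    compact set, which is almost an eigenvector for [a] as well. The continuous
    function sending [(a, y)] to [a *: y - K y] has no zero on the compact set of
    pairs with [a] in the annulus and [y] away from 0, so its values stay away
    from 0. *)
Lemma compact_op_bounded_below (K : V -> V) (e B : R) : compact_op K ->
    (forall a x, a != 0 -> x != 0 -> K x <> a *: x) -> 0 < e ->
  exists2 d : R, 0 < d & forall a x, e <= nrm a -> nrm a <= B ->
    d * nrm x <= nrm (a *: x - K x).
Proof.
move=> cK noeig e0; have bK := compact_opW cK.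
have [lK [D cD KD]] := cK; have [k k0 Kk] := bounded_op_gt0 bK.
have [E cE BE] := disc_sub_compact B.
pose g (p : R[i]^o * V) : V := p.1 *: p.2 - K p.2.
have gc : continuous g.
  move=> p; apply: (@cvgB _ V _ _ _ (fun p : R[i]^o * V => p.1 *: p.2)).
    exact: scale_continuous.
  apply: (@continuous_comp _ _ _ snd K); first exact: cvg_snd.
  exact: bounded_op_continuous.
pose A := (E `*` D) `&` [set p : R[i]^o * V | e <= nrm p.1 /\ e / 2 <= nrm p.2].
have cA : compact A.
  apply: compact_closedI; first exact: compact_setX.
  apply: closedI.
    apply: (@closed_comp _ _ (fun p : R[i]^o * V => nrm p.1) [set t | e <= t]).
      move=> p _; apply: (@continuous_comp _ _ _ fst (@nrm R R[i]^o)).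
        exact: cvg_fst.
      exact: nrm_continuous.
    exact: closed_ge.
  apply: (@closed_comp _ _ (fun p : R[i]^o * V => nrm p.2) [set t | e / 2 <= t]).
    move=> p _; apply: (@continuous_comp _ _ _ snd (@nrm R V)).
      exact: cvg_snd.
    exact: nrm_continuous.
  exact: closed_ge.
have cgA : closed (g @` A).
  apply: compact_closed; first exact: norm_hausdorff.
  by apply: continuous_compact cA; exact: continuous_subspaceT.
have [c c0 gAc] : exists2 c : R, 0 < c & forall p, A p -> c <= nrm (g p).
  have : nbhs (0 : V) (~` (g @` A)).
    apply: open_nbhs_nbhs; split; first exact: closed_openC.
    move=> [[a y] [_ /= [ea ey]] /eqP]; rewrite /g /= subr_eq0 => /eqP ayK.
    apply: (noeig a y); rewrite -?nrm_gt0 //; first exact: lt_le_trans ea.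
    by apply: lt_le_trans ey; rewrite divr_gt0.
  move=> /nbhs_nrmP[c c0 cA0]; exists c => // p Ap; rewrite leNgt; apply/negP.
  by move=> gpc; apply: (cA0 (g p)); [rewrite sub0r nrmN|exists p].
exists (Num.min (e / 2) (c / k)).
  by rewrite lt_min !divr_gt0.
move=> a x ea aB; have [->|x0] := eqVneq x 0.
  by rewrite nrm0 mulr0 nrm_ge0.
have nx : 0 < nrm x by rewrite nrm_gt0.
pose u := (nrm x)^-1%:C *: x.
have u1 : nrm u = 1.
  by rewrite /u nrmZr ger0_norm ?invr_ge0 ?nrm_ge0 // mulVf // gt_eqF.
suff : Num.min (e / 2) (c / k) <= nrm (a *: u - K u).
  rewrite /u (linZ lK) scalerA (mulrC a) -scalerA -scalerBr nrmZr.
  by rewrite ger0_norm ?invr_ge0 ?nrm_ge0 // [leRHS]mulrC ler_pdivlMr.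
rewrite ge_min; have [//|/= ue] := leP (e / 2) (nrm (a *: u - K u)).
rewrite ler_pdivrMr // mulrC; apply: le_trans _ (Kk _).
rewrite (linB lK) (linZ lK); apply: (gAc (a, K u)); split=> /=.
  by split=> /=; [exact: BE|apply: KD; rewrite u1].
split=> //; have := nrm_le_sub (a *: u) (K u).
by have := nrm_le_sub (a *: u) (a *: u - K u); rewrite subKr nrmZ u1 mulr1; lra.
Qed.

End BoundedBelow.

Section RealPowers.
Context {R : realType}.
Implicit Types q s c : R.

Lemma bernoulli s n : 0 <= s <= 1 -> 1 - n%:R * s <= (1 - s) ^+ n.
Proof.
move=> /andP[s0 s1]; elim: n => [|n IH]; first by rewrite mul0r subr0 expr0.
rewrite exprS; apply: le_trans (_ : (1 - s) * (1 - n%:R * s) <= _).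
  have : 0 <= n%:R * s * s by rewrite !mulr_ge0.
  by rewrite -natr1; nra.
by rewrite ler_wpM2l // subr_ge0.
Qed.

Lemma natr_expr_le q n : 0 <= q < 1 -> n.+1%:R * q ^+ n <= (1 - q)^-1.
Proof.
move=> /andP[q0 q1]; rewrite -div1r ler_pdivlMr ?subr_gt0 //.
apply: le_trans (_ : 1 - q ^+ n.+1 <= _); last by rewrite gerBl exprn_ge0.
elim: n => [|n IH]; first by rewrite expr0 expr1; lra.
have qn1 : q ^+ n.+1 <= 1 by rewrite exprn_ile1 // ltW.
have : 0 <= (1 - q) * (1 - q ^+ n.+1) by rewrite mulr_ge0 // subr_ge0 // ltW.
move: IH; rewrite -(natr1 n.+1) !exprS => IH h.
by have := ler_wpM2l q0 IH; move: h; nra.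
Qed.

Lemma ex_natr_gt c : exists n : nat, c <= n%:R.
Proof.
by exists (Num.bound `|c|); apply: le_trans (ler_norm c) (ltW (archi_boundP _)).
Qed.

Lemma ex_expr_le q c : 0 <= q < 1 -> 0 < c -> exists n : nat, q ^+ n <= c.
Proof.
move=> q01 c0; have /andP[q0 q1] := q01.
have [n nc] := ex_natr_gt ((c * (1 - q))^-1); exists n.
have n0 : 0 < n.+1%:R :> R by rewrite ltr0Sn.
rewrite -(ler_pM2l n0); apply: le_trans (natr_expr_le _ q01) _.
have d0 : 0 < 1 - q by rewrite subr_gt0.
rewrite -ler_pdivrMr // -invfM mulrC; apply: le_trans nc _.
by rewrite ler_nat.
Qed.

Lemma ex_natr_expr_le q c N : 0 <= q < 1 -> 0 <= c ->
  exists2 n : nat, (N <= n)%N & n.+1%:R * q ^+ n * c <= 1.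
Proof.
move=> q01 c0; have /andP[q0 q1] := q01.
have d0 : 0 < 1 - q by rewrite subr_gt0.
have b0 : 0 < 2 * (1 - q)^-1 * (c + 1).
  by rewrite !mulr_gt0 ?invr_gt0 // ltr_wpDl.
have [n nc] := ex_expr_le q01 (etrans (invr_gt0 _) b0).
have qN : q ^+ (n + N) <= q ^+ n.
  by rewrite exprD ler_piMr ?exprn_ge0 // exprn_ile1 // ltW.
exists (2 * (n + N))%N; first by lia.
(* half of the exponent absorbs the linear factor *)
set m := (n + N)%N in qN *; have qm0 : 0 <= q ^+ m by exact: exprn_ge0.
rewrite mul2n -addnn exprD mulrA.
apply: le_trans (_ : 2 * (1 - q)^-1 * q ^+ m * (c + 1) <= _).
  apply: ler_pM; rewrite ?lerDl ?mulr_ge0 //.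
  apply: ler_wpM2r => //; apply: le_trans (_ : (2 * m.+1%:R) * q ^+ m <= _).
    by rewrite ler_wpM2r // -natrM ler_nat; lia.
  by rewrite -mulrA ler_wpM2l // natr_expr_le.
rewrite mulrAC; apply: le_trans (ler_wpM2l (ltW b0) (le_trans qN nc)) _.
by rewrite mulfV // gt_eqF.
Qed.

End RealPowers.

Lemma prim_root_exists {F : numClosedFieldType} n : (0 < n)%N ->
  exists w : F, n.-primitive_root w.
Proof.
move=> n_gt0; pose p : {poly F} := 'X^n - 1.
have [r Dp] := closed_field_poly_normal p.
rewrite (monicP _) ?monicXnsubC // scale1r in Dp.
have rn1 : all n.-unity_root r.
  by apply/allP=> z; rewrite -root_prod_XsubC -Dp.
have sz_r : (n < (size r).+1)%N.
  by rewrite -(size_prod_XsubC r id) -Dp size_XnsubC.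
have [|z _ zn] := hasP (has_prim_root n_gt0 rn1 _ sz_r); last by exists z.
by rewrite -separable_prod_XsubC -Dp separable_Xn_sub_1 // pnatr_eq0 -lt0n.
Qed.

Section Powers.
Context {R : realType} {V : normedModType R[i]}.

(** Cauchy's estimate for a vector-valued polynomial: averaging over the [m]-th
    roots of unity against a character extracts one coefficient. *)
Lemma cauchy_estimate m (a : 'I_m -> V) (c : R) :
    (forall z : R[i], nrm z = 1 -> nrm (\sum_(l < m) z ^+ l *: a l) <= c) ->
  forall i, nrm (a i) <= c.
Proof.
move=> ac i; have m0 : (0 < m)%N by apply: leq_ltn_trans (ltn_ord i).
have [w wm] := @prim_root_exists R[i] m m0.
have w1 : nrm w = 1.
  have /eqP := congr1 nrm (prim_expr_order wm).
  by rewrite nrmX nrm1 pexpr_eq1 ?nrm_ge0 // => /eqP.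
have mR : 0 < m%:R :> R by rewrite ltr0n.
rewrite -(ler_pM2l mR) -nrm_nat -nrmZ.
have -> : m%:R *: a i =
    \sum_(j < m) w ^+ (j * (m - i)) *: \sum_(l < m) (w ^+ j) ^+ l *: a l.
  under eq_bigr do rewrite scaler_sumr; rewrite exchange_big /=.
  have sumE (l : 'I_m) : \sum_(j < m) w ^+ (j * (m - i)) *: ((w ^+ j) ^+ l *: a l)
      = (\sum_(j < m) (w ^+ (m - i + l)) ^+ j) *: a l.
    rewrite scaler_suml; apply: eq_bigr => j _.
    by rewrite scalerA -!exprM -exprD; congr (w ^+ _ *: _); nia.
  rewrite (eq_bigr _ (fun l _ => sumE l)) (bigD1 i) //= [X in _ + X]big1 => [|l li].
    rewrite addr0 subnK 1?ltnW // (prim_expr_order wm).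
    under eq_bigr do rewrite expr1n.
    by rewrite sumr_const card_ord.
  (* the other sums are geometric with a ratio different from 1 *)
  have : w ^+ (m - i + l) - 1 != 0.
    rewrite subr_eq0 -(prim_order_dvd wm); apply/negP => /dvdnP[[|[|t]]].
    + by have := ltn_ord i; lia.
    + have := ltn_ord i => im h; case/eqP: li; apply: val_inj => /=.
      by move: h; lia.
    + by have := ltn_ord l; have := ltn_ord i; nia.
  move=> /mulfI h; rewrite [X in X *: _](_ : _ = 0) ?scale0r //.
  apply: h; rewrite mulr0 -subrX1.
  by rewrite -exprM mulnC exprM (prim_expr_order wm) expr1n subrr.
apply: le_trans (nrm_sum _) _.
rewrite nrm_nat mulr_natl -[X in c *+ X]card_ord -sumr_const.
apply: ler_sum => j _; rewrite nrmZ nrmX w1 expr1n mul1r.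
by apply: ac; rewrite nrmX w1 expr1n.
Qed.

(** The derivative of the geometric sum: it is the truncated Neumann series of
    the square of a resolvent. *)
Lemma sqr_resolvent_sum (W : V -> V) (E := fun y => y - W y) m x : linear W ->
  E (E (\sum_(l < m) l.+1%:R *: iter l W x)) =
  x - m.+1%:R *: iter m W x + m%:R *: iter m.+1 W x.
Proof.
move=> lW; have ED y z : E (y + z) = E y + E z.
  by rewrite /E (linD lW) opprD addrACA.
have EED y z : E (E (y + z)) = E (E y) + E (E z) by rewrite (ED y z) (ED (E y)).
elim: m => [|m IH].
  by rewrite big_ord0 /E (lin0 lW) subr0 (lin0 lW) scale1r scale0r addr0 !subrr.
have -> : \sum_(l < m.+1) l.+1%:R *: iter l W x =
    \sum_(l < m) l.+1%:R *: iter l W x + m.+1%:R *: iter m W x.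
  by rewrite big_ord_recr.
rewrite EED IH /E !(linB lW) !(linZ lW).
rewrite -!iterS; set u := iter m W x; set v := iter _ W x; set w := iter _ W x.
rewrite -(natr1 m.+1) -(natr1 m) !scalerDl !scale1r.
move: (m%:R *: u) (m%:R *: v) (m%:R *: w) => a b c.
move: (a + u) (c + w) => {a c u w}a c; rewrite opprB !addrA.
rewrite [LHS](ACl ((3*5)*1*7*6*(2*4))) /= addNr addr0.
have -> : b - (b + v) = - v by rewrite opprD addrA subrr add0r.
by congr (_ + _); rewrite (addrC _ x) [in RHS](opprD (b + v) v) addrA addrAC.
Qed.

End Powers.

Section Growth.
Context {R : realType} {V : normedModType R[i]}.
Implicit Types (K : V -> V) (x : V).

Definition power_growth K (mu : R) :=
  exists2 C : R, 0 <= C & forall n x, nrm (iter n K x) <= C * mu ^+ n * nrm x.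

Lemma iter_scale K (a : R[i]) n x : linear K ->
  iter n (fun y => a *: K y) x = a ^+ n *: iter n K x.
Proof.
move=> lK; elim: n => [|n IH] /=; first by rewrite scale1r.
by rewrite IH (linZ lK) scalerA -exprS.
Qed.

Lemma power_growth_of_one_power K (nu : R) i : (0 < i)%N -> 0 < nu ->
    bounded_op K -> (forall x, nrm (iter i K x) <= nu ^+ i * nrm x) ->
  power_growth K nu.
Proof.
move=> i0 nu0 bK Ki; have [k k0 Kk] := bounded_op_gt0 bK.
pose c := 1 + k / nu; have c1 : 1 <= c by rewrite lerDl divr_ge0 // ltW.
have kc : k <= c * nu.
  by rewrite mulrDl mul1r divfK ?gt_eqF // lerDr ltW.
exists (c ^+ i) => [|n x]; first by rewrite exprn_ge0 // (le_trans ler01).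
have Kqi q y : nrm (iter (q * i) K y) <= nu ^+ (q * i) * nrm y.
  elim: q => [|q IH]; first by rewrite mul0n expr0 mul1r.
  rewrite mulSn iterD exprD -mulrA; apply: le_trans (Ki _) _.
  by rewrite ler_wpM2l // exprn_ge0 // ltW.
rewrite {1}(divn_eq n i) iterD; apply: le_trans (Kqi _ _) _.
apply: le_trans (ler_wpM2l _ (iter_bound (ltW k0) Kk _ _)) _.
  by rewrite exprn_ge0 // ltW.
rewrite mulrA ler_wpM2r ?nrm_ge0 // [in leRHS](divn_eq n i) exprD mulrCA.
apply: ler_wpM2l; first by rewrite exprn_ge0 // ltW.
apply: le_trans (_ : (c * nu) ^+ (n %% i) <= _).
  by rewrite lerXn2r // nnegrE ltW // mulr_gt0 // (lt_le_trans ltr01).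
rewrite exprMn ler_wpM2r ?exprn_ge0 ?(ltW nu0) //.
by rewrite ler_weXn2l // ltnW // ltn_mod.
Qed.

(** Cauchy's estimate on the circle [nrm a = nu], on which the growth hypothesis
    makes the truncated Neumann series of the resolvent converge. It is applied
    to the square of the resolvent, bounded there by [d ^- 2], because the [i]-th
    coefficient of this square carries the factor [i.+1]. *)
Lemma power_bound K (nu d q : R) i x : linear K -> 0 < nu -> 0 < d ->
    0 <= q < 1 -> power_growth K (q * nu) ->
    (forall a y, nrm a = nu -> d * nrm y <= nrm (a *: y - K y)) ->
  i.+1%:R * nrm (iter i K x) <= 2 * (nu / d) ^+ 2 * nu ^+ i * nrm x.
Proof.
move=> lK nu0 d0 q01 [C C0 KC] Kd; have /andP[q0 q1] := q01.
have nd0 : 0 <= nu / d by rewrite divr_ge0 // ltW.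
have [m im mC] : exists2 m : nat, (i < m)%N & m.+1%:R * q ^+ m * (2 * C) <= 1.
  by apply: ex_natr_expr_le => //; rewrite mulr_ge0.
have nuC : (nu%:C : R[i]) != 0 by rewrite gt_eqF // ltcR.
have nnu : nrm (nu%:C : R[i]) = nu by rewrite nrm_real gtr0_norm.
pose U y := nu^-1%:C *: K y.
have lU : linear U.
  by move=> a y z; rewrite /U lK scalerDr !scalerA (mulrC a).
have UE n y : nrm (iter n U y) = nu ^- n * nrm (iter n K y).
  by rewrite iter_scale // nrmZ nrmX nrm_real gtr0_norm ?invr_gt0 // exprVn.
have Um n y : nrm (iter n U y) <= C * q ^+ n * nrm y.
  rewrite UE ler_pdivrMl ?exprn_gt0 //; apply: le_trans (KC n y) _.
  by rewrite exprMn !mulrA [_ * nu ^+ n]mulrC !mulrA.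
suff H : nrm (i.+1%:R *: iter i U x) <= 2 * (nu / d) ^+ 2 * nrm x.
  move: H; rewrite nrmZ nrm_nat UE mulrCA ler_pdivrMl ?exprn_gt0 // => H.
  by apply: le_trans H _; rewrite mulrCA !mulrA.
apply: (@cauchy_estimate _ _ m (fun l => l.+1%:R *: iter l U x) _ _ (Ordinal im)).
move=> z z1; pose W y := z *: U y.
have lW : linear W.
  by move=> a u v; rewrite /W lU scalerDr !scalerA (mulrC a).
have -> : \sum_(l < m) z ^+ l *: (l.+1%:R *: iter l U x) =
    \sum_(l < m) l.+1%:R *: iter l W x.
  by apply: eq_bigr => l _; rewrite /W (iter_scale z l x lU) !scalerA mulrC.
have z0 : z != 0 by rewrite -nrm_gt0 z1.
have WE y : nrm y <= nu / d * nrm (y - W y).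
  have -> : y - W y = (z / nu%:C) *: ((nu%:C / z) *: y - K y).
    rewrite scalerBr scalerA mulrA divfK // divff // scale1r /W /U scalerA.
    by rewrite fmorphV.
  rewrite nrmZ !nrmM nrmV nnu z1 mul1r mulrACA mulfV ?gt_eqF // mul1r.
  rewrite ler_pdivlMl //; apply: Kd.
  by rewrite nrmM nrmV nnu z1 invr1 mulr1.
have := sqr_resolvent_sum m x lW.
set S := \sum_(l < m) _ => SE.
apply: le_trans (WE S) _; apply: le_trans (ler_wpM2l nd0 (WE _)) _.
have -> : 2 * (nu / d) ^+ 2 * nrm x = nu / d * (nu / d * (2 * nrm x)) by ring.
rewrite SE; do 2 (apply: ler_wpM2l => //).
have Wm n y : nrm (iter n W y) <= C * q ^+ n * nrm y.
  by rewrite (iter_scale z n y lU) nrmZ nrmX z1 expr1n mul1r.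
apply: le_trans (nrmD _ _) _.
apply: le_trans (lerD (nrm_sub_le _ _) (lexx _)) _.
rewrite (nrmZ _ (iter m W x)) (nrmZ _ (iter m.+1 W x)) !nrm_nat.
have h1 := ler_wpM2l (ler0n R m.+1) (Wm m x).
have h2 : m%:R * nrm (iter m.+1 W x) <= m.+1%:R * (C * q ^+ m * nrm x).
  apply: ler_pM; rewrite ?nrm_ge0 ?ler_nat //; apply: le_trans (Wm _ _) _.
  rewrite ler_wpM2r ?nrm_ge0 // ler_wpM2l // exprS ler_piMl ?exprn_ge0 //.
  exact: ltW.
have := ler_wpM2r (nrm_ge0 x) mC; rewrite mul1r.
have {h1 h2} h3 := lerD h1 h2.
have -> : m.+1%:R * q ^+ m * (2 * C) * nrm x =
  m.+1%:R * (C * q ^+ m * nrm x) + m.+1%:R * (C * q ^+ m * nrm x) by ring.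
move=> h4; rewrite -addrA [2 * _]mulr_natl mulr2n lerD2l.
exact: le_trans h3 h4.
Qed.

(** For [i] large the factor [i.+1] of [power_bound] gives
    [nrm (iter i K x) <= 2^-1 * nu ^+ i * nrm x], where [nu = mu / (1 - s)]. By
    Bernoulli's inequality [2^-1 <= (1 - s) ^+ (2 * i)], which pays both for the
    passage from [mu] to the larger radius [nu] and for the decrease of the growth
    rate to [(1 - s) * mu]. *)
Lemma power_growth_step K (e B d mu : R) i (s := (4 * i%:R)^-1) :
    bounded_op K -> 0 < e -> 0 < d -> (0 < i)%N -> 4 * (B / d) ^+ 2 <= i%:R ->
    (forall a y, e <= nrm a -> nrm a <= B -> d * nrm y <= nrm (a *: y - K y)) ->
    e <= mu -> mu / (1 - s) <= B ->
  power_growth K mu -> power_growth K ((1 - s) * mu).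
Proof.
move=> bK e0 d0 i0 iB Kd emu muB Kmu.
have iR : 1 <= i%:R :> R by rewrite ler1n.
have s0 : 0 < s by rewrite invr_gt0 mulr_gt0 // (lt_le_trans ltr01).
have s1 : s <= 4^-1.
  by rewrite lef_pV2 ?posrE ?mulr_gt0 // ?(lt_le_trans ltr01) //; lra.
have q0 : 0 < 1 - s by lra.
have mu0 : 0 < mu by apply: lt_le_trans emu.
set nu := mu / (1 - s) in muB; have nu0 : 0 < nu by rewrite divr_gt0.
have munu : mu = (1 - s) * nu by rewrite mulrC divfK // gt_eqF.
clearbody nu.
have enu : e <= nu by apply: le_trans emu _; rewrite munu ler_piMl // ltW //; lra.
apply: (power_growth_of_one_power i0) => // [|x]; first exact: mulr_gt0.
have q01 : 0 <= 1 - s < 1 by apply/andP; split; lra.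
have Kmu' : power_growth K ((1 - s) * nu) by rewrite -munu.
have Knu a y : nrm a = nu -> d * nrm y <= nrm (a *: y - K y).
  by move=> anu; apply: Kd; rewrite anu.
have H := power_bound i x bK.1 nu0 d0 q01 Kmu' Knu.
have half : 2^-1 <= (1 - s) ^+ (2 * i).
  apply: le_trans (bernoulli _ _); last by apply/andP; split; lra.
  rewrite natrM /s invfM mulrACA mulfV ?gt_eqF ?(lt_le_trans ltr01) //; lra.
have -> : ((1 - s) * mu) ^+ i = (1 - s) ^+ (2 * i) * nu ^+ i.
  by rewrite munu mulrA -expr2 exprMn -exprM.
have iS0 : 0 < i.+1%:R :> R by rewrite ltr0Sn.
rewrite -(ler_pM2l iS0); apply: le_trans H _.
rewrite [leRHS]mulrA [in leRHS](mulrA i.+1%:R).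
apply: ler_wpM2r; first exact: nrm_ge0.
apply: ler_wpM2r; first by rewrite exprn_ge0 // ltW.
have ndB : (nu / d) ^+ 2 <= (B / d) ^+ 2.
  have B0 : 0 <= B := le_trans (ltW nu0) muB.
  apply: lerXn2r; rewrite ?nnegrE.
  - exact: divr_ge0 (ltW nu0) (ltW d0).
  - exact: divr_ge0 B0 (ltW d0).
  - by apply: ler_wpM2r muB; rewrite invr_ge0 ltW.
apply: le_trans (_ : i.+1%:R * 2^-1 <= _); last by rewrite ler_pM2l.
by rewrite -(natr1 i); lra.
Qed.

(** The classical proof compares the spectral radius formula with the Fredholm
    alternative. Here the growth rate of the powers is pushed down below [e] by
    finitely many steps of [power_growth_step]: as the absence of nonzero
    eigenvalues bounds [K - a] from below uniformly on the whole annulus, each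
    step multiplies the rate by the same factor. *)
Theorem compact_op_quasinilpotent K : compact_op K ->
    (forall a x, a != 0 -> x != 0 -> K x <> a *: x) ->
  forall e : R, 0 < e -> power_growth K e.
Proof.
move=> cK noeig e e0; have bK := compact_opW cK.
have [k k0 Kk] := bounded_op_gt0 bK.
pose r := k + e; have r0 : 0 < r by rewrite addr_gt0.
have Kr : power_growth K r.
  exists 1 => // n x; rewrite mul1r; apply: iter_bound (ltW r0) _ _ _ => y.
  by apply: le_trans (Kk y) _; rewrite ler_wpM2r ?nrm_ge0 // lerDl ltW.
have [d d0 Kd] := compact_op_bounded_below (2 * r) cK noeig e0.
have [i' Hi'] := ex_natr_gt (4 * (2 * r / d) ^+ 2); pose i := i'.+1.
have Hi : 4 * (2 * r / d) ^+ 2 <= i%:R.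
  by apply: le_trans Hi' _; rewrite ler_nat.
pose s : R := (4 * i%:R)^-1.
have iR : 1 <= i%:R :> R by rewrite ler1n.
have s0 : 0 < s by rewrite invr_gt0 mulr_gt0 // (lt_le_trans ltr01).
have s1 : s <= 4^-1.
  by rewrite lef_pV2 ?posrE ?mulr_gt0 // ?(lt_le_trans ltr01) //; lra.
have mono mu nu : 0 <= mu -> mu <= nu -> power_growth K mu -> power_growth K nu.
  move=> mu0 munu [C C0 KC]; exists C => // n x; apply: le_trans (KC n x) _.
  rewrite ler_wpM2r ?nrm_ge0 // ler_wpM2l // lerXn2r // nnegrE //.
  exact: le_trans munu.
have Kj j : power_growth K (Num.max e ((1 - s) ^+ j * r)).
  elim: j => [|j IH].
    by rewrite mul1r; apply: mono Kr; [exact: ltW|rewrite le_max lexx orbT].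
  set mu := Num.max _ _ in IH; have emu : e <= mu by rewrite le_max lexx.
  have mur : mu <= r.
    rewrite ge_max {1}/r lerDr (ltW k0) /= ler_piMl ?(ltW r0) //.
    by rewrite exprn_ile1 //; lra.
  have muB : mu / (1 - s) <= 2 * r by rewrite ler_pdivrMr //; [nra|lra].
  have := power_growth_step bK e0 d0 (ltn0Sn _) Hi Kd emu muB IH.
  have q0 : 0 <= 1 - s by lra.
  apply: mono; first exact: mulr_ge0 q0 (le_trans (ltW e0) emu).
  rewrite /mu (maxr_pMr _ _ q0).
  rewrite mulrA -exprS ge_max !le_max lexx orbT andbT.
  by rewrite ler_piMl // ?ltW //; lra.
have [j Hj] : exists j : nat, (1 - s) ^+ j <= e / r.
  by apply: ex_expr_le; [apply/andP; split; lra|rewrite divr_gt0].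
have := Kj j; rewrite max_l //; by rewrite -ler_pdivlMr.
Qed.

End Growth.

(** * Hyperinvariant subspaces *)

Section Subspaces.
Context {R : realType} {V : normedModType R[i]}.
Implicit Types (U W : set V) (S T K : V -> V) (x y : V).

Definition linear_set W := W 0 /\ forall (a : R[i]) x y, W x -> W y -> W (a *: x + y).

Definition nontrivial_closed W :=
  [/\ closed W, linear_set W, exists2 x, W x & x != 0 & exists y, ~ W y].

Definition stable_set T W := forall x, W x -> W (T x).

Lemma closure_linear_set U : linear_set U -> linear_set (closure U).
Proof.
move=> [U0 UD]; split=> [|a x y /closure_nrmP Ux /closure_nrmP Uy].
  exact: subset_closure.
apply/closure_nrmP => e e0; have a1 : 0 < nrm a + 1 by rewrite ltr_wpDl ?nrm_ge0.
have [|x' Ux' xx'] := Ux (e / 2 / (nrm a + 1)); first by rewrite !divr_gt0.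
have [|y' Uy' yy'] := Uy (e / 2); first by rewrite divr_gt0.
exists (a *: x' + y'); first exact: UD.
rewrite opprD addrACA -scalerBr; apply: le_lt_trans (nrmD _ _) _.
rewrite nrmZ (splitr e); apply: ler_ltD => //.
apply: le_trans (_ : (nrm a + 1) * nrm (x - x') <= _).
  by rewrite ler_wpM2r ?nrm_ge0 // lerDl.
by rewrite mulrC -ler_pdivlMr // ltW.
Qed.

Lemma closure_stable T U : bounded_op T -> stable_set T U -> stable_set T (closure U).
Proof.
move=> bT TU x /closure_nrmP Ux; apply/closure_nrmP => e e0.
have [c c0 Tc] := bounded_op_gt0 bT.
have [|y Uy xy] := Ux (e / c); first by rewrite divr_gt0.
exists (T y); first exact: TU.
rewrite -(linB bT.1); apply: le_lt_trans (Tc _) _.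
by rewrite mulrC -ltr_pdivlMr.
Qed.

Lemma closed_kernel T : bounded_op T -> closed [set x | T x = 0].
Proof.
move=> bT; apply/closed_nrmP => x Tx; have [c c0 Tc] := bounded_op_gt0 bT.
apply/eqP; rewrite -nrm_eq0 eq_le nrm_ge0 andbT; apply/ler_addgt0Pl => e e0.
have [|y /= Ty xy] := Tx (e / c); first by rewrite divr_gt0.
rewrite addr0 -[T x]subr0 -Ty -(linB bT.1); apply: le_trans (Tc _) _.
by rewrite mulrC -ler_pdivlMr // ltW.
Qed.

Lemma linear_kernel T : linear T -> linear_set [set x | T x = 0].
Proof.
move=> lT; split=> [|a x y /= Tx Ty]; first by rewrite /= lin0.
by rewrite lT Tx Ty scaler0 addr0.
Qed.

Definition commutant T S := bounded_op S /\ forall x, S (T x) = T (S x).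

(** Hilden's form of Lomonosov's argument. If no closed subspace is invariant
    under the commutant of [K], then from any nonzero vector the commutant comes
    within distance 1 of [x0]. By compactness the operators that bring the image
    under [K] of the unit ball around [x0] back into this ball can be chosen with
    a common bound [c]. Playing this game [n] times moves [iter n K x0] back into
    the ball with an operator of norm at most [c ^+ n], and this is absurd as
    [iter n K x0] decays faster than any geometric sequence. *)
Theorem quasinilpotent_hyperinvariant K : compact_op K ->
    (exists x, K x != 0) -> (forall e : R, 0 < e -> power_growth K e) ->
  exists2 W, nontrivial_closed W & forall S, commutant K S -> stable_set S W.
Proof.
move=> cK [x1 Kx1] qK; have bK := compact_opW cK.
have [lK [D cD KD]] := cK; have [k k0 Kk] := bounded_op_gt0 bK.
pose orbit x := [set S x | S in commutant K].
have orbit_lin x : linear_set (orbit x).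
  split.
    exists (fun y => 0 *: y); last by rewrite scale0r.
    by split=> [|y]; [exact: bounded_op_scale|rewrite !scale0r lin0].
  move=> a _ _ [S [bS SK] <-] [S' [bS' SK'] <-].
  exists (fun y => a *: S y + S' y) => //; split.
    exact: bounded_op_add (bounded_op_comp (bounded_op_scale a) bS) bS'.
  by move=> y; rewrite SK SK' lK.
have orbit_stable x S : commutant K S -> stable_set S (orbit x).
  move=> [bS SK] _ [S' [bS' SK'] <-]; exists (S \o S') => //; split.
    exact: bounded_op_comp.
  by move=> y /=; rewrite SK' SK.
have [[x [x0 [z xz]]]|dense] := pselect (exists x, x != 0 /\
    exists z, ~ closure (orbit x) z).
  exists (closure (orbit x)); last first.
    by move=> S KS; apply: closure_stable (orbit_stable _ _ KS); exact: KS.1.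
  split; [exact: closed_closure|exact: closure_linear_set| |by exists z].
  exists x => //; apply: subset_closure; exists id => //.
  by split=> //; exact: bounded_op_id.
exfalso; have {}dense x z : x != 0 -> closure (orbit x) z.
  by move=> x0; apply: contrapT => xz; apply: dense; exists x; split=> //; exists z.
have nK1 : 0 < nrm (K x1) by rewrite nrm_gt0.
(* so long that [K] keeps the unit ball around [x0] at distance at least [k] from 0 *)
pose x0 := (2 * k / nrm (K x1))%:C *: x1.
have Kx0 : nrm (K x0) = 2 * k.
  by rewrite (linZ lK) nrmZr ger0_norm ?divfK ?gt_eqF // divr_ge0 ?mulr_ge0 // ltW.
have nx0 : 2 <= nrm x0.
  by rewrite -(ler_pM2l k0) mulrC -Kx0 Kk.
pose rho := nrm x0 + 1; have rho0 : 0 < rho by rewrite ltr_wpDl ?nrm_ge0.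
pose D' := ((fun y => rho%:C *: y) @` D) `&` [set y | k <= nrm y].
have cD' : compact D'.
  apply: compact_closedI.
    apply: continuous_compact cD; apply: continuous_subspaceT.
    exact/bounded_op_continuous/bounded_op_scale.
  apply: (@closed_comp _ _ (@nrm R V) [set t | k <= t]).
    by move=> y _; exact: nrm_continuous.
  exact: closed_ge.
have KD' x : nrm (x - x0) <= 1 -> D' (K x).
  move=> xx0; split; last first.
    rewrite /=; have := nrm_le_sub (K x0) (K x0 - K x).
    have := Kk (x0 - x); rewrite subKr -(linB lK) (nrmB x0 x) Kx0.
    by have := ler_wpM2l (ltW k0) xx0; lra.
  exists (K (rho^-1%:C *: x)).
    apply: KD; rewrite nrmZr ger0_norm ?invr_ge0 ?(ltW rho0) //.
    rewrite ler_pdivrMl // mulr1 /rho; have := nrm_le_sub x x0.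
    by move: xx0; lra.
  by rewrite (linZ lK) scalerA -rmorphM /= divff ?gt_eqF // scale1r.
(* [back n] grows with [n], so by compactness a single [n] serves for [D'] *)
pose back (n : nat) y := exists S, [/\ commutant K S,
  forall z, nrm (S z) <= n%:R * nrm z & nrm (S y - x0) < 1].
have [N HN] : exists N : nat, forall y, D' y -> back N y.
  have : near_covering D' by apply/compact_near_coveringP.
  move=> /(_ nat \oo back _) [|N _ HN]; last by exists N; exact: (HN N (leqnn N)).
  move=> y [_ /= ky]; have y0 : y != 0 by rewrite -nrm_gt0 (lt_le_trans k0).
  have /closure_nrmP/(_ 1 ltr01)[_ [S KS <-] Sy] := dense y x0 y0.
  have [c c0 Sc] := bounded_op_gt0 KS.1; have [n nc] := ex_natr_gt c.
  exists ([set y' | nrm (S y' - x0) < 1], [set m | (n <= m)%N]).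
    split; last by exists n.
    apply: open_nbhs_nbhs; split; last by rewrite /= nrmB.
    apply: (@open_nrm_lt _ _ _ (fun y' => S y' - x0)) => y'.
    by apply: cvgB; [exact: bounded_op_continuous KS.1 y'|exact: cvg_cst].
  move=> [y' m] [/= Sy' nm]; exists S; split=> // z.
  apply: le_trans (Sc z) _; rewrite ler_wpM2r ?nrm_ge0 //.
  by apply: le_trans nc _; rewrite ler_nat.
pose c : R := N%:R + 1; have c0 : 0 < c by rewrite ltr_wpDl.
have game n : exists S, [/\ commutant K S,
    forall z, nrm (S z) <= c ^+ n * nrm z & nrm (S (iter n K x0) - x0) <= 1].
  elim: n => [|n [S [KS Sc Sx0]]].
    exists id; split=> [|z|]; last by rewrite /= subrr nrm0.
      by split=> //; exact: bounded_op_id.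
    by rewrite mul1r.
  have [S' [KS' Sc' Sx0']] := HN _ (KD' _ Sx0); exists (S' \o S); split.
  - split; first exact: bounded_op_comp KS'.1 KS.1.
    by move=> z /=; rewrite KS.2 KS'.2.
  - move=> z; apply: le_trans (Sc' _) _; rewrite exprS -mulrA.
    apply: ler_pM; rewrite ?nrm_ge0 //.
    by rewrite lerDl.
  - by rewrite /= KS.2 ltW.
have [C C0 KC] : power_growth K (2 * c)^-1 by apply: qK; rewrite invr_gt0 mulr_gt0.
have [n Hn] : exists n : nat, 2^-1 ^+ n <= (2 * (C * nrm x0 + 1))^-1.
  apply: ex_expr_le; first by apply/andP; split; lra.
  by rewrite invr_gt0 mulr_gt0 // ltr_wpDl ?mulr_ge0 ?nrm_ge0.
have [S [_ Sc]] := game n; have := nrm_le_sub x0 (x0 - S (iter n K x0)).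
rewrite subKr (nrmB x0) => h1 h2.
have h3 : nrm (S (iter n K x0)) <= 2^-1.
  apply: le_trans (Sc _) _.
  apply: le_trans (ler_wpM2l (exprn_ge0 n (ltW c0)) (KC n x0)) _.
  have -> : c ^+ n * (C * (2 * c)^-1 ^+ n * nrm x0) = 2^-1 ^+ n * (C * nrm x0).
    have -> : 2^-1 ^+ n = c ^+ n * (2 * c)^-1 ^+ n.
      by rewrite -exprMn invfM mulrCA divff ?mulr1 ?gt_eqF.
    by rewrite !mulrA (mulrAC (c ^+ n) C).
  apply: le_trans (ler_wpM2r _ Hn) _; first by rewrite mulr_ge0 ?nrm_ge0.
  have Cx0 : 0 < C * nrm x0 + 1 by rewrite ltr_wpDl ?mulr_ge0 ?nrm_ge0.
  by rewrite mulrC ler_pdivrMr ?mulr_gt0 // mulrA mulVf ?mul1r ?lerDl // gt_eqF.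
by move: h1 h2 h3 nx0; lra.
Qed.

(** If [T] has an eigenvalue, then the eigenspace is hyperinvariant. Otherwise, as
    [R[i]] is algebraically closed, no nonconstant polynomial in [T] has an
    eigenvalue, and those that are compact are therefore quasinilpotent. *)
Theorem polynomially_compact_hyperinvariant T (p : {poly R[i]}) : bounded_op T ->
    p != 0 -> compact_op (poly_op p T) -> (forall a, exists x, T x != a *: x) ->
  exists2 W, nontrivial_closed W & forall S, commutant T S -> stable_set S W.
Proof.
move=> bT p0 cp Tscal; have lT := bT.1.
have [[a [x [x0 Tx]]]|noeig] := pselect (exists a x, x != 0 /\ T x = a *: x).
  pose E y := T y - a *: y.
  have bE : bounded_op E by exact: bounded_op_sub bT (bounded_op_scale a).
  exists [set y | E y = 0]; last first.
    move=> S [bS ST] y /= Ey.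
    by rewrite /E -ST -(linZ bS.1) -(linB bS.1) -/(E y) Ey (lin0 bS.1).
  split; [exact: closed_kernel|exact: linear_kernel bE.1| |].
    by exists x; rewrite //= /E Tx subrr.
  by have [y Ty] := Tscal a; exists y => /= /eqP; rewrite subr_eq0 (negbTE Ty).
have poly_inj (q : {poly R[i]}) x : q != 0 -> x != 0 -> poly_op q T x != 0.
  have [r ->] := closed_field_poly_normal q.
  rewrite scaler_eq0 negb_or lead_coef_eq0 poly_opZ scaler_eq0 negb_or.
  rewrite lead_coef_eq0 => /andP[-> _] x0 /=.
  elim: r x x0 => [|z r IH] x x0.
    by rewrite big_nil -[1]/(1%:P) poly_opC scale1r.
  rewrite big_cons mulrC (poly_opM lT); apply: IH; apply/negP => /eqP.
  rewrite -polyCN poly_opD poly_opX poly_opC scaleNr => /subr0_eq Tx.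
  by apply: noeig; exists z, x.
(* the extra factor 'X keeps the polynomial from being constant *)
pose q := p * 'X; have q0 : q != 0 by rewrite mulf_neq0 // polyX_eq0.
have qT : poly_op q T = poly_op p T \o T by apply/funext => x; rewrite poly_op_MX.
have cq : compact_op (poly_op q T) by rewrite qT; exact: compact_op_compr.
have noeigq a x : a != 0 -> x != 0 -> poly_op q T x <> a *: x.
  move=> _ x0 /eqP; rewrite -subr_eq0 -scaleNr -(poly_opC (- a) T) -poly_opD.
  apply/negP/poly_inj => //; rewrite polyCN subr_eq0; apply/eqP => qa.
  have := size_polyC_leq1 a; rewrite -qa size_mulX // ltnS leqn0 size_poly_eq0.
  by rewrite (negbTE p0).
have [x Tx] := Tscal 0; have x0 : x != 0.
  by apply: contra_neq Tx => ->; rewrite (lin0 lT) scaler0.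
have [||W WV WS] := quasinilpotent_hyperinvariant cq.
- by exists x; exact: poly_inj.
- exact: compact_op_quasinilpotent noeigq.
exists W => // S [bS ST]; apply: WS; split=> // y.
by rewrite (poly_op_comm q bS.1 ST).
Qed.

End Subspaces.

(** * Nilpotent families have invariant subspaces *)

Section Derivation.
Context {K : comNzRingType} {V : lmodType K}.
Implicit Types (A B : V -> V) (p : {poly K}).

(** [commutator], over any module. *)
Definition comm_op A B := fun x => A (B x) - B (A x).

Lemma linear_comm_op A B : linear A -> linear B -> linear (comm_op A B).
Proof.
move=> lA lB a x y; rewrite /comm_op lB lA lA lB.
by rewrite scalerBr opprD addrACA.
Qed.

Lemma comm_op_comm S A B : linear S -> (forall x, S (A x) = A (S x)) ->
  (forall x, S (B x) = B (S x)) -> forall x, S (comm_op A B x) = comm_op A B (S x).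
Proof. by move=> lS SA SB x; rewrite /comm_op linB // SA SB SB SA. Qed.

(** Bracketing with [A] is a derivation, so on polynomials in [B] it acts through
    the formal derivative when [comm_op A B] commutes with [B]. *)
Lemma comm_op_poly A B p : linear A -> linear B ->
    (forall x, comm_op A B (B x) = B (comm_op A B x)) ->
  forall x, comm_op A (poly_op p B) x = poly_op p^`() B (comm_op A B x).
Proof.
move=> lA lB CB; elim/poly_ind: p => [|p c IH] x.
  by rewrite deriv0 /comm_op !poly_op0 lin0 // subrr.
rewrite derivD derivC addr0 derivM derivX mulr1 poly_opD poly_op_MX -CB -IH.
rewrite /comm_op !poly_opD !poly_op_MX !poly_opC (linD lA) (linZ lA).
rewrite opprD addrACA subrr addr0 (linB (linear_poly_op lB p)).
by rewrite addrA subrK.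
Qed.

Lemma poly_opXn B n x : poly_op 'X^n B x = iter n B x.
Proof.
elim: n x => [|n IH] x; first by rewrite expr0 -[1]/(1%:P) poly_opC scale1r.
by rewrite exprSr poly_op_MX IH iterSr.
Qed.

End Derivation.

Section Nilpotent.
Context {R : realType} {V : normedModType R[i]}.
Implicit Types (A B S T : V -> V) (F : set (V -> V)).

(** The Wintner-Wielandt theorem. In the identity
    [comm_op A (iter n.+1 B) x = n.+1%:R * l *: iter n B x] the norm of the left-hand
    side is at most a bound of [iter n B] times a constant that does not depend on
    [n]. If [l != 0], this forces [iter n B = 0] for large [n], and the same
    identity then brings [n] down to 0, so that [id = 0]. *)
Lemma comm_op_scalar_eq0 A B (l : R[i]) : bounded_op A -> bounded_op B ->
  (forall x, comm_op A B x = l *: x) -> (exists x : V, x != 0) -> l = 0.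
Proof.
move=> bA bB AB [x0 nx0]; apply/eqP/negP => /negP l0.
have [lA lB] := (bA.1, bB.1).
have [a a0 Aa] := bounded_op_gt0 bA; have [b b0 Bb] := bounded_op_gt0 bB.
have ABn n x : A (iter n.+1 B x) - iter n.+1 B (A x) = n.+1%:R *: (l *: iter n B x).
  have := comm_op_poly 'X^(n.+1) lA lB _ x; rewrite /comm_op !poly_opXn => ->.
    by rewrite -/(comm_op A B x) AB derivXn -scaler_nat poly_opZ poly_opXn /= (linZ (linear_iter n lB)).
  by move=> y; rewrite -/(comm_op A B (B y)) -/(comm_op A B y) !AB (linZ lB).
have ll0 : 0 < nrm l by rewrite nrm_gt0.
have [n Hn] := ex_natr_gt (4 * (a * b) / nrm l).
(* for this [n], any bound of [iter n B] can be halved *)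
have step c : (forall x, nrm (iter n B x) <= c * nrm x) ->
    forall x, nrm (iter n B x) <= c / 2 * nrm x.
  move=> Bc x; have := ABn n x => /(congr1 nrm); rewrite !nrmZ nrm_nat => E.
  have h1 : nrm (A (iter n.+1 B x)) <= a * (b * (c * nrm x)).
    apply: le_trans (Aa _) _; rewrite ler_pM2l //; apply: le_trans (Bb _) _.
    by rewrite ler_pM2l // Bc.
  have h2 : nrm (iter n.+1 B (A x)) <= b * (c * (a * nrm x)).
    apply: le_trans (Bb _) _; rewrite ler_pM2l //; apply: le_trans (Bc _) _.
    have [c0|c0] := leP 0 c; first exact: ler_wpM2l.
    have := le_trans (nrm_ge0 _) (Bc (A x)).
    have := le_trans (nrm_ge0 _) (Bc x).
    rewrite !nmulr_rge0 // => h h'; have nx : nrm x = 0 by apply/le_anti; rewrite h nrm_ge0.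
    have nAx : nrm (A x) = 0 by apply/le_anti; rewrite h' nrm_ge0.
    by rewrite nx nAx !mulr0.
  have h3 := nrm_sub_le (A (iter n.+1 B x)) (iter n.+1 B (A x)).
  rewrite E in h3.
  have h4 : 4 * (a * b) <= n.+1%:R * nrm l.
    by rewrite -ler_pdivrMr //; apply: le_trans Hn _; rewrite ler_nat.
  have ab0 : 0 < 4 * (a * b) by rewrite !mulr_gt0.
  rewrite -(ler_pM2l ab0); apply: le_trans (ler_wpM2r (nrm_ge0 (iter n B x)) h4) _.
  rewrite -[leLHS]mulrA; apply: le_trans h3 _; apply: le_trans (lerD h1 h2) _.
  by rewrite le_eqVlt; apply/orP; left; apply/eqP; field.
have Bn0 x : iter n B x = 0.
  apply/eqP; rewrite -nrm_eq0 eq_le nrm_ge0 andbT; apply/ler_addgt0Pl => e e0.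
  rewrite addr0; have [c c0 Bc] := (bounded_op_iter n bB).2.
  have Bcj j y : nrm (iter n B y) <= 2^-1 ^+ j * c * nrm y.
    elim: j y => [|j IH] y; first by rewrite mul1r; exact: Bc.
    by rewrite exprSr [_ * _ * c]mulrAC; apply: step.
  have cx : 0 < c * nrm x + 1 by rewrite ltr_wpDl ?mulr_ge0 ?nrm_ge0.
  have [j Hj] : exists j : nat, 2^-1 ^+ j <= e / (c * nrm x + 1).
    by apply: ex_expr_le; [apply/andP; split; lra|rewrite divr_gt0].
  apply: le_trans (Bcj j x) _; rewrite -mulrA.
  apply: le_trans (ler_wpM2r _ Hj) _; first by rewrite mulr_ge0 ?nrm_ge0.
  by rewrite mulrAC ler_pdivrMr // ler_pM2l // lerDl.
elim: n Bn0 {Hn step} => [|n IH] Bn0; first by have := Bn0 x0 => /eqP; apply/negP.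
apply: IH => x; have := ABn n x; rewrite !Bn0 (lin0 lA) subrr => /esym/eqP.
by rewrite !scaler_eq0 pnatr_eq0 (negbTE l0) => /eqP.
Qed.

(** Bracketing a compact polynomial in [B] with [A] [n] times gives a compact
    operator, the [n]-th derivative of [p] at [B] times [iter n C]; when [n] is
    the degree of [p] this derivative is a nonzero constant. *)
Lemma compact_iter_comm_op A B (p : {poly R[i]}) (C := comm_op A B) :
    bounded_op A -> bounded_op B -> p != 0 -> compact_op (poly_op p B) ->
    (forall x, C (A x) = A (C x)) -> (forall x, C (B x) = B (C x)) ->
  compact_op (iter (size p).-1 C).
Proof.
move=> bA bB p0 cp CA CB; have [lA lB] := (bA.1, bB.1).
have lC : linear C by exact: linear_comm_op.
have key n : compact_op (poly_op p^`(n) B \o iter n C).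
  elim: n => [|n IH]; first by rewrite derivn0.
  have -> : poly_op p^`(n.+1) B \o iter n.+1 C =
      fun x => A ((poly_op p^`(n) B \o iter n C) x) -
               (poly_op p^`(n) B \o iter n C) (A x).
    apply/funext => x /=.
    rewrite -(comm_op_poly _ lA lB CB) /comm_op; congr (_ - poly_op _ _ _).
    by rewrite (iter_comm _ (fun y => esym (CA y))).
  exact: compact_op_sub (compact_op_compl bA IH) (compact_op_compr bA IH).
set n := (size p).-1; have sp : size p = n.+1.
  by rewrite prednK // lt0n size_poly_eq0.
pose c := lead_coef p *+ n`!.
have c0 : c != 0.
  by rewrite mulrn_eq0 negb_or -lt0n fact_gt0 lead_coef_eq0.
have pn : p^`(n) = c%:P.
  apply/polyP => i; rewrite coef_derivn coefC; case: i => [|i] /=.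
    by rewrite addn0 ffactnn /c lead_coefE.
  by rewrite nth_default ?mul0rn // sp addnS ltnS leq_addr.
have := compact_op_scale c^-1 (key n); congr compact_op; apply/funext => x /=.
by rewrite pn poly_opC scalerA mulVf // scale1r.
Qed.

(** [iter_commutators], over a normed space, as quotients require. *)
Fixpoint lower_comm F (k : nat) : set (V -> V) :=
  if k is k'.+1 then [set comm_op A B | A in lower_comm F k' & B in F] else F.

Lemma bounded_comm_op A B : bounded_op A -> bounded_op B -> bounded_op (comm_op A B).
Proof.
move=> bA bB; exact: bounded_op_sub (bounded_op_comp bA bB) (bounded_op_comp bB bA).
Qed.

Lemma bounded_lower_comm F k : (forall T, F T -> bounded_op T) ->
  forall T, lower_comm F k T -> bounded_op T.
Proof.
move=> bF; elim: k => //= k IH _ [A FA] [B FB <-].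
by apply: bounded_comm_op; [exact: IH|exact: bF].
Qed.

Lemma commute_lower_comm F k S : linear S ->
    (forall T, F T -> forall x, S (T x) = T (S x)) ->
  forall T, lower_comm F k T -> forall x, S (T x) = T (S x).
Proof.
move=> lS SF; elim: k => //= k IH _ [A FA] [B FB <-].
by apply: comm_op_comm => //; [exact: IH|exact: SF].
Qed.

(** In the last nonzero level of brackets every operator [C] commutes with the
    family, so the hyperinvariant subspaces of [C] are invariant under it. On
    the ground level [C] can be any nonscalar member of the family, or else [L]
    itself is invariant. On higher levels a power of [C] is compact, and [C] is
    not a scalar by the Wintner-Wielandt theorem. *)
Theorem nilpotent_invariant_subspace F (L : set V) k :
    (forall T, F T -> bounded_op T) ->
    (forall T, F T -> exists2 p : {poly R[i]}, p != 0 & compact_op (poly_op p T)) ->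
    (forall T, lower_comm F k T -> forall x, T x = 0) -> nontrivial_closed L ->
  exists2 W, nontrivial_closed W & forall T, F T -> stable_set T W.
Proof.
move=> bF cF Fk Ltriv; elim: k Fk => [|k IH] Fk.
  by exists L => // T /Fk T0 x _; rewrite T0; have [_ []] := Ltriv.
have [Fk0|] := pselect (forall T, lower_comm F k T -> forall x, T x = 0).
  exact: IH.
move=> /existsNP[C /not_implyP[FkC /existsNP[x0 /eqP Cx0]]].
have bC := bounded_lower_comm bF FkC.
have CF T : F T -> forall x, C (T x) = T (C x).
  move=> FT x; apply/eqP; rewrite -subr_eq0; apply/eqP.
  by apply: (Fk (comm_op C T)); exists C => //; exists T.
have hyper S (p : {poly R[i]}) : bounded_op S -> p != 0 ->
    compact_op (poly_op p S) -> (forall a, exists x, S x != a *: x) ->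
    (forall T, F T -> forall x, S (T x) = T (S x)) ->
    exists2 W, nontrivial_closed W & forall T, F T -> stable_set T W.
  move=> bS p0 cp Sscal SF.
  have [W WV WS] := polynomially_compact_hyperinvariant bS p0 cp Sscal.
  by exists W => // T FT; apply: WS; split=> [|x]; [exact: bF|rewrite SF].
case: k => [|k] in FkC Fk IH *.
  have [Fscal|] := pselect (forall T, F T -> exists a : R[i], forall x, T x = a *: x).
    exists L => // T /Fscal[a Ta] x Lx; rewrite Ta.
    by have [_ [L0 LD] _ _] := Ltriv; rewrite -[_ *: _]addr0; exact: LD.
  move=> /existsNP[T /not_implyP[FT Tscal]]; have [p p0 cp] := cF T FT.
  apply: (hyper T p) => // [||S FS x]; first exact: bF.
    move=> a; apply: contrapT => Ta; apply: Tscal; exists a => x.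
    by apply: contrapT => /eqP Tx; apply: Ta; exists x.
  apply/eqP; rewrite -subr_eq0; apply/eqP.
  by apply: (Fk (comm_op T S)); exists T => //; exists S.
have [A FkA [B FB CE]] := FkC.
have bA := bounded_lower_comm bF FkA; have bB := bF _ FB.
have [p p0 cp] := cF B FB.
have CA x : C (A x) = A (C x).
  exact: (commute_lower_comm bC.1 CF FkA).
have CB x := CF B FB x.
apply: (hyper C 'X^((size p).-1)) => //.
- by rewrite monic_neq0 // monicXn.
- have -> : poly_op 'X^((size p).-1) C = iter (size p).-1 C.
    by apply/funext => x; rewrite poly_opXn.
  by rewrite -CE in CA CB *; exact: compact_iter_comm_op CA CB.
move=> a; apply: contrapT => Ca.
have {}Ca x : C x = a *: x by apply: contrapT => /eqP Cx; apply: Ca; exists x.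
have a0 : a = 0.
  apply: (comm_op_scalar_eq0 bA bB); first by rewrite CE.
  by exists (C x0).
by move: Cx0; rewrite Ca a0 scale0r eqxx.
Qed.

End Nilpotent.

(** * Subquotients of a normed space *)

Section Distance.
Context {R : realType} {X : normedModType R[i]} (N : set X).
Context (cN : closed N) (lN : linear_set N).
Implicit Types x y n : X.

Lemma linear_setZ (a : R[i]) x : N x -> N (a *: x).
Proof. by move=> Nx; rewrite -[a *: x]addr0; apply: lN.2 => //; exact: lN.1. Qed.

Lemma linear_setD x y : N x -> N y -> N (x + y).
Proof. by move=> Nx Ny; rewrite -[x]scale1r; exact: lN.2. Qed.

Lemma linear_setN x : N x -> N (- x).
Proof. by rewrite -scaleN1r; exact: linear_setZ. Qed.

Lemma linear_setB x y : N x -> N y -> N (x - y).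
Proof. by move=> Nx /linear_setN; exact: linear_setD. Qed.

Definition dist_set x := inf [set nrm (x - n) | n in N].

Let has_inf_dist x : has_inf [set nrm (x - n) | n in N].
Proof.
split; first by exists (nrm (x - 0)); exists 0 => //; exact: lN.1.
by exists 0 => _ [n _ <-]; exact: nrm_ge0.
Qed.

Lemma dist_set_le x n : N n -> dist_set x <= nrm (x - n).
Proof. by move=> Nn; apply: (inf_lbound (has_inf_dist x).2); exists n. Qed.

Lemma dist_set_lt x (e : R) : 0 < e -> exists2 n, N n & nrm (x - n) < dist_set x + e.
Proof.
by move=> e0; have [_ [n Nn <-] h] := inf_adherent e0 (has_inf_dist x); exists n.
Qed.

Lemma dist_set_ge0 x : 0 <= dist_set x.
Proof.
by apply: lb_le_inf => [|_ [n _ <-]]; [exact: (has_inf_dist x).1|exact: nrm_ge0].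
Qed.

Lemma dist_set_le_nrm x : dist_set x <= nrm x.
Proof. by rewrite -[X in nrm X]subr0; apply: dist_set_le; exact: lN.1. Qed.

Lemma dist_set_eq x y : N (x - y) -> dist_set x = dist_set y.
Proof.
move=> Nxy; apply/le_anti/andP; split; apply/ler_addgt0Pl => e e0.
  have [n Nn /ltW h] := dist_set_lt y e0; rewrite addrC; apply: le_trans h.
  have -> : y - n = x - (x - y + n) by rewrite opprD opprB addrA subrKC.
  by apply: dist_set_le; exact: linear_setD.
have [n Nn /ltW h] := dist_set_lt x e0; rewrite addrC; apply: le_trans h.
have -> : x - n = y - (n - (x - y)) by rewrite !opprB addrA addrCA subrr addr0.
by apply: dist_set_le; exact: linear_setB.
Qed.

Lemma dist_setD x y : dist_set (x + y) <= dist_set x + dist_set y.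
Proof.
apply/ler_addgt0Pl => e e0; have e2 : 0 < e / 2 by rewrite divr_gt0.
have [n Nn h] := dist_set_lt x e2; have [m Nm h'] := dist_set_lt y e2.
apply: le_trans (dist_set_le _ (linear_setD Nn Nm)) _.
by rewrite opprD addrACA; have := nrmD (x - n) (y - m); lra.
Qed.

Lemma dist_set_linear T (c : R) x : 0 <= c -> linear T -> stable_set T N ->
  (forall y, nrm (T y) <= c * nrm y) -> dist_set (T x) <= c * dist_set x.
Proof.
move=> c0 lT TN Tc; apply/ler_addgt0Pl => e e0.
have c1 : 0 < c + 1 by rewrite ltr_wpDl.
have [|n Nn /ltW h] := dist_set_lt x (e := e / (c + 1)); first by rewrite divr_gt0.
apply: le_trans (dist_set_le _ (TN _ Nn)) _; rewrite -(linB lT).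
apply: le_trans (Tc _) _; apply: le_trans (ler_wpM2l c0 h) _.
rewrite mulrDr addrC lerD2r mulrCA ler_piMr ?(ltW e0) // ler_pdivrMr // mul1r.
by rewrite lerDl.
Qed.

Lemma dist_setZ (a : R[i]) x : dist_set (a *: x) = nrm a * dist_set x.
Proof.
have leZ b y : dist_set (b *: y) <= nrm b * dist_set y.
  apply: (@dist_set_linear (fun y => b *: y)); rewrite ?nrm_ge0 //.
  - by move=> c u v; rewrite scalerDr !scalerA mulrC.
  - by move=> n; exact: linear_setZ.
  - by move=> z; rewrite nrmZ.
apply/le_anti; rewrite leZ /=; have [->|a0] := eqVneq a 0.
  by rewrite nrm0 mul0r dist_set_ge0.
rewrite -ler_pdivlMl ?nrm_gt0 // -nrmV -[X in dist_set X <= _](scalerK a0).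
exact: leZ.
Qed.

Lemma dist_set_eq0 x : dist_set x = 0 -> N x.
Proof.
move=> x0; apply: (closed_nrmP _).1 => // e e0.
by have [n Nn] := dist_set_lt x e0; rewrite x0 add0r; exists n.
Qed.

End Distance.

Section Subquotient.
Context {R : realType} {X : normedModType R[i]}.

Record subquotient (M N : set X) : Prop := Subquotient {
  sq_closedM : closed M;
  sq_linM : linear_set M;
  sq_closedN : closed N;
  sq_linN : linear_set N;
  sq_sub : N `<=` M }.

(** Classes modulo [N] are encoded by chosen representatives, which makes the
    quotient [M / N] a subtype of the space. *)
Definition class_repr (N : set X) (x : X) : X := xget 0 [set y | N (x - y)].

Definition quot (M N : set X) (h : subquotient M N) : Type :=
  {x : X | `[< M x /\ class_repr N x = x >]}.

Context {M N : set X} (h : subquotient M N).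
Let lM := sq_linM h.
Let lN := sq_linN h.
Implicit Types (x y : X) (u v w : quot h).

Lemma class_reprP x : N (x - class_repr N x).
Proof.
rewrite /class_repr; case: xgetP => [y -> //|/(_ x)].
by rewrite /= subrr => /(_ lN.1).
Qed.

Lemma class_repr_eq x y : N (x - y) -> class_repr N x = class_repr N y.
Proof.
move=> Nxy; rewrite /class_repr; congr xget; apply/seteqP; split=> z /= Nz.
  by rewrite -(subrKA x) -opprB; apply: linear_setD => //; exact: linear_setN.
by rewrite -(subrKA y); exact: linear_setD.
Qed.

Lemma class_reprM x : M x -> M (class_repr N x).
Proof.
move=> Mx; rewrite -[class_repr N x](subKr x).
by apply: linear_setB => //; apply: (sq_sub h); exact: class_reprP.
Qed.

Lemma class_repr_idem x : class_repr N (class_repr N x) = class_repr N x.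
Proof.
by apply: class_repr_eq; rewrite -opprB; apply: linear_setN => //; exact: class_reprP.
Qed.

Let quot0 : quot h.
Proof.
exists (class_repr N 0); apply/asboolP; split; last exact: class_repr_idem.
by apply: class_reprM; exact: lM.1.
Defined.

(** The projection of [M] onto [M / N], with a dummy value outside [M]. *)
Definition proj x : quot h := insubd quot0 (class_repr N x).

Lemma valM u : M (val u).
Proof. by have /asboolP[] := valP u. Qed.

Lemma val_proj x : M x -> val (proj x) = class_repr N x.
Proof.
move=> Mx; rewrite val_insubd ifT //; apply/asboolP; split; first exact: class_reprM.
exact: class_repr_idem.
Qed.

Lemma proj_val u : proj (val u) = u.
Proof. by apply: val_inj; rewrite val_proj ?valM //; have /asboolP[] := valP u. Qed.

Lemma proj_eq x y : M x -> M y -> proj x = proj y <-> N (x - y).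
Proof.
move=> Mx My; split=> [/(congr1 val)|Nxy].
  rewrite !val_proj // => E; rewrite -(subrKA (class_repr N x)).
  apply: linear_setD => //; first exact: class_reprP.
  by rewrite E -opprB; apply: linear_setN => //; exact: class_reprP.
by apply: val_inj; rewrite !val_proj //; exact: class_repr_eq.
Qed.

Lemma val_proj_sub x : M x -> N (x - val (proj x)).
Proof. by move=> Mx; rewrite val_proj //; exact: class_reprP. Qed.

HB.instance Definition _ := Choice.on (quot h).

Definition quot_add u v := proj (val u + val v).
Definition quot_opp u := proj (- val u).
Definition quot_scale (a : R[i]) u := proj (a *: val u).

Lemma quot_addE x y : M x -> M y -> quot_add (proj x) (proj y) = proj (x + y).
Proof.
move=> Mx My; apply/esym/proj_eq; try by apply: linear_setD => //; exact: valM.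
by rewrite opprD addrACA; apply: linear_setD => //; exact: val_proj_sub.
Qed.

Lemma quot_scaleE a x : M x -> quot_scale a (proj x) = proj (a *: x).
Proof.
move=> Mx; apply/esym/proj_eq; try by apply: linear_setZ => //; exact: valM.
by rewrite -scalerBr; apply: linear_setZ => //; exact: val_proj_sub.
Qed.

Lemma quot_oppE u : quot_opp u = quot_scale (-1) u.
Proof. by rewrite /quot_opp /quot_scale scaleN1r. Qed.

Let MD x y : M x -> M y -> M (x + y). Proof. exact: linear_setD. Qed.
Let MZ (a : R[i]) x : M x -> M (a *: x). Proof. exact: linear_setZ. Qed.
Local Hint Resolve valM MD MZ : core.

Lemma quot_addA : associative quot_add.
Proof.
by move=> u v w; rewrite -[u]proj_val -[v]proj_val -[w]proj_val !quot_addE ?addrA; auto.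
Qed.

Lemma quot_addC : commutative quot_add.
Proof. by move=> u v; rewrite /quot_add addrC. Qed.

Lemma quot_add0 : left_id (proj 0) quot_add.
Proof.
by move=> u; rewrite -[u]proj_val quot_addE ?add0r; auto; exact: lM.1.
Qed.

Lemma quot_addN : left_inverse (proj 0) quot_opp quot_add.
Proof.
move=> u; rewrite quot_oppE -[u]proj_val quot_scaleE ?quot_addE; auto.
by rewrite scaleN1r addNr.
Qed.

HB.instance Definition _ := GRing.isZmodule.Build (quot h)
  quot_addA quot_addC quot_add0 quot_addN.

Lemma projD x y : M x -> M y -> proj (x + y) = proj x + proj y.
Proof. by move=> Mx My; rewrite -quot_addE. Qed.

Lemma proj0 : proj 0 = 0. Proof. by []. Qed.

Lemma quot_scaleA (a b : R[i]) u : quot_scale a (quot_scale b u) = quot_scale (a * b) u.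
Proof. by rewrite -[u]proj_val !quot_scaleE ?scalerA; auto. Qed.

Lemma quot_scale1 : left_id 1 quot_scale.
Proof. by move=> u; rewrite -[u]proj_val quot_scaleE ?scale1r; auto. Qed.

Lemma quot_scaleDr : right_distributive quot_scale +%R.
Proof.
move=> a u v; rewrite -[u]proj_val -[v]proj_val -projD ?quot_scaleE; auto.
by rewrite scalerDr projD; auto.
Qed.

Lemma quot_scaleDl v : {morph quot_scale^~ v : a b / a + b}.
Proof.
by move=> a b; rewrite -[v]proj_val !quot_scaleE ?scalerDl ?projD; auto.
Qed.

HB.instance Definition _ := GRing.Zmodule_isLmodule.Build R[i] (quot h)
  quot_scaleA quot_scale1 quot_scaleDr quot_scaleDl.

Lemma projZ a x : M x -> proj (a *: x) = a *: proj x.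
Proof. by move=> Mx; rewrite -quot_scaleE. Qed.

Definition quot_norm u : R[i] := (dist_set N (val u))%:C.

Lemma quot_normE x : M x -> quot_norm (proj x) = (dist_set N x)%:C.
Proof.
move=> Mx; congr _%:C; apply/esym/dist_set_eq => //; exact: val_proj_sub.
Qed.

Lemma quot_normD u v : quot_norm (u + v) <= quot_norm u + quot_norm v.
Proof.
rewrite -[u]proj_val -[v]proj_val -projD ?quot_normE; auto.
by rewrite -rmorphD lecR; exact: dist_setD.
Qed.

Lemma quot_normZ (a : R[i]) u : quot_norm (a *: u) = `|a| * quot_norm u.
Proof.
rewrite -[u]proj_val -projZ ?quot_normE; auto.
by rewrite dist_setZ // rmorphM /= -nrmE.
Qed.

Lemma quot_norm_eq0 u : quot_norm u = 0 -> u = 0.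
Proof.
rewrite -[u]proj_val quot_normE; auto => /complexI/(dist_set_eq0 (sq_closedN h) lN) Nu.
by rewrite -proj0; apply/proj_eq; rewrite ?subr0 //; exact: lM.1.
Qed.

HB.instance Definition _ := Lmodule_isNormed.Build R[i] (quot h)
  quot_normD quot_normZ quot_norm_eq0.

Lemma nrm_proj x : M x -> nrm (proj x) = dist_set N x.
Proof. by move=> Mx; rewrite /nrm [`|_|]quot_normE. Qed.

Lemma nrm_proj_le x : M x -> nrm (proj x) <= nrm x.
Proof. by move=> Mx; rewrite nrm_proj //; exact: dist_set_le_nrm. Qed.

Lemma projB x y : M x -> M y -> proj (x - y) = proj x - proj y.
Proof.
move=> Mx My; rewrite -[- y]scaleN1r projD; auto.
by rewrite projZ // scaleN1r.
Qed.

Lemma proj_eq0 x : M x -> proj x = 0 <-> N x.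
Proof. by move=> Mx; rewrite -proj0 proj_eq ?subr0 //; exact: lM.1. Qed.

Lemma proj_continuous : {within M, continuous proj}.
Proof.
apply/subspace_continuousP => x Mx A /nbhs_nrmP[e e0 eA].
rewrite /nbhs /= /within /=; apply/nbhs_nrmP; exists e => // y xy My.
apply: eA; rewrite -projB //; apply: le_lt_trans xy.
by apply: nrm_proj_le; apply: linear_setB.
Qed.

Lemma proj_lift u (r : R) : nrm u < r -> exists2 x, M x /\ nrm x < r & proj x = u.
Proof.
rewrite -[u]proj_val nrm_proj //; set d := dist_set N _ => dr.
have [|n Nn hn] := dist_set_lt lN (val u) (e := r - d); first by rewrite subr_gt0.
have Mn : M n by exact: (sq_sub h).
exists (val u - n).
  split; first by apply: linear_setB.
  by move: hn; rewrite -/d subrKC.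
by apply/proj_eq => //; [exact: linear_setB|rewrite addrAC subrr add0r; exact: linear_setN].
Qed.

(** * Operators on a subquotient *)

Definition quot_op (T : X -> X) u := proj (T (val u)).

Definition compatible_op (T : X -> X) :=
  [/\ linear T, stable_set T M & stable_set T N].

Lemma quot_opE T x : compatible_op T -> M x -> quot_op T (proj x) = proj (T x).
Proof.
move=> [lT TM TN] Mx; apply/proj_eq; auto; rewrite -(linB lT); apply: TN.
by rewrite -opprB; apply: linear_setN => //; exact: val_proj_sub.
Qed.

Lemma linear_quot_op T : compatible_op T -> linear (quot_op T).
Proof.
move=> cT a u v; rewrite -[u]proj_val -[v]proj_val -projZ // -projD; auto.
have [lT TM _] := cT.
by rewrite !quot_opE // ?lT ?projD ?projZ; auto.
Qed.

Lemma bounded_quot_op T :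
  compatible_op T -> bounded_op T -> bounded_op (quot_op T).
Proof.
move=> cT [_ [c c0 Tc]]; split; first exact: linear_quot_op.
have [lT TM TN] := cT; exists c => // u; rewrite -[u]proj_val quot_opE // !nrm_proj; auto.
exact: dist_set_linear.
Qed.

Lemma compatible_comm_op A B :
  compatible_op A -> compatible_op B -> compatible_op (comm_op A B).
Proof.
move=> [lA AM AN] [lB BM BN]; split; first exact: linear_comm_op.
  by move=> x Mx; apply: linear_setB; auto.
by move=> x Nx; apply: linear_setB; auto.
Qed.

Lemma quot_comm_op A B : compatible_op A -> compatible_op B ->
  quot_op (comm_op A B) = comm_op (quot_op A) (quot_op B).
Proof.
move=> cA cB; apply/funext => u; rewrite -[u]proj_val quot_opE //; last first.
  exact: compatible_comm_op.
have [[_ AM _] [_ BM _]] := (cA, cB).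
by rewrite /comm_op !quot_opE ?projB; auto.
Qed.

Lemma compatible_poly_op T p : compatible_op T -> compatible_op (poly_op p T).
Proof.
move=> [lT TM TN]; split; first exact: linear_poly_op.
  elim/poly_ind: p => [|p c IH] x Mx; first by rewrite poly_op0; exact: lM.1.
  by rewrite poly_opD poly_op_MX poly_opC; auto.
elim/poly_ind: p => [|p c IH] x Nx; first by rewrite poly_op0; exact: lN.1.
rewrite poly_opD poly_op_MX poly_opC; apply: linear_setD; auto.
exact: linear_setZ.
Qed.

Lemma quot_poly_op T p : compatible_op T ->
  poly_op p (quot_op T) = quot_op (poly_op p T).
Proof.
move=> cT; apply/funext => u; rewrite -[u]proj_val; move: (val u) (valM u) => x Mx.
rewrite quot_opE //; last exact: compatible_poly_op.
have [lT TM _] := cT; have pM q y : M y -> M (poly_op q T y).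
  by have [_ + _] := compatible_poly_op q cT; apply.
elim/poly_ind: p x Mx => [|p c IH] x Mx; first by rewrite !poly_op0 proj0.
rewrite !poly_opD !poly_op_MX !poly_opC quot_opE // IH; auto.
by rewrite projD ?projZ; auto.
Qed.

Lemma compact_quot_op T : compatible_op T -> compact_op T -> compact_op (quot_op T).
Proof.
move=> cT [lT [D cD TD]]; split; first exact: linear_quot_op.
have [_ TM TN] := cT.
pose D2 := ((fun x => 2%:C *: x) @` D) `&` M.
exists (proj @` D2) => [|u u1].
  apply: continuous_compact.
    by apply: continuous_subspaceW proj_continuous => x [].
  apply: compact_closedI; last exact: (sq_closedM h).
  apply: continuous_compact cD; apply: continuous_subspaceT.
  exact/bounded_op_continuous/bounded_op_scale.
have [|x [Mx x2] <-] := @proj_lift u 2; first by apply: le_lt_trans u1 _; lra.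
exists (T x); last by rewrite quot_opE.
split; last exact: TM.
exists (T (2^-1%:C *: x)).
  by apply: TD; rewrite nrmZr ger0_norm ?invr_ge0 // ler_pdivrMl // mulr1 ltW.
by rewrite (linZ lT) scalerA -rmorphM /= divff ?pnatr_eq0 // scale1r.
Qed.

Lemma lower_comm_quot (F : set (X -> X)) k :
    (forall T, F T -> compatible_op T) ->
  forall S, lower_comm [set quot_op T | T in F] k S ->
  exists T, [/\ lower_comm F k T, compatible_op T & S = quot_op T].
Proof.
move=> cF; elim: k => [|k IH] S /=.
  by move=> [T FT <-]; exists T; split; auto.
move=> [A /IH[A' [FA' cA' ->]]] [_ [B' FB' <-] <-].
exists (comm_op A' B'); split; last by rewrite quot_comm_op; auto.
  by exists A' => //; exists B'.
by apply: compatible_comm_op; auto.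
Qed.

(** The invariant subspaces of [M / N] correspond to those of the ambient space
    between [N] and [M]. *)
Theorem subquotient_invariant_subspace (F : set (X -> X)) (L : set X) k :
    (forall T, F T -> compatible_op T) ->
    (forall T, F T -> bounded_op T) ->
    (forall T, F T -> exists2 p : {poly R[i]}, p != 0 & compact_op (poly_op p T)) ->
    (forall T, lower_comm F k T -> forall x, T x = 0) ->
    closed L -> linear_set L -> N `<=` L -> L `<=` M -> L <> N -> L <> M ->
  exists W, [/\ closed W, linear_set W, N `<=` W /\ W `<=` M, W <> N /\ W <> M &
    forall T, F T -> stable_set T W].
Proof.
move=> compF bF cF Fk cL lL NL LM LN0 LM0.
have neqP (A B : set X) : A `<=` B -> A <> B -> exists2 x, B x & ~ A x.
  move=> AB nAB; apply: contrapT => nex; apply: nAB; apply/seteqP; split=> // x Bx.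
  by apply: contrapT => Ax; apply: nex; exists x.
have [x0 Lx0 Nx0] := neqP _ _ NL (fun e => LN0 (esym e)).
have [y0 My0 Ly0] := neqP _ _ LM LM0.
pose LQ : set (quot h) := [set u | L (val u)].
have LQE x : M x -> LQ (proj x) <-> L x.
  move=> Mx; have Nx := val_proj_sub Mx; rewrite /LQ /=; split=> Lx.
    by rewrite -[x](subrK (val (proj x))); apply: linear_setD; auto.
  by rewrite -(subKr x (val (proj x))); apply: linear_setB; auto.
have LQtriv : nontrivial_closed LQ.
  split.
  - apply/closed_nrmP => u Lu; apply: ((closed_nrmP L).1 cL) => e e0.
    have [v Lv uv] := Lu e e0.
    have [x [Mx xe] xuv] := proj_lift uv.
    have Nn : N (val u - val v - x).
      apply/proj_eq => //; [exact: linear_setB|].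
      by rewrite projB // !proj_val.
    exists (val v + (val u - val v - x)); last first.
      by rewrite [X in nrm (_ - X)]addrA subrKC subKr.
    by apply: linear_setD => //; exact: NL.
  - split=> [|a u v Lu Lv]; first by apply/(LQE 0); [exact: lM.1|exact: lL.1].
    rewrite -[u]proj_val -[v]proj_val -projZ // -projD; auto.
    by apply/LQE; auto; apply: lL.2.
  - exists (proj x0); first by apply/LQE; auto.
    by apply/eqP => /(proj_eq0 (LM _ Lx0)).
  - by exists (proj y0) => /(LQE _ My0).
have [|||W [cW lW [u Wu u0] [v Wv]] WS] :=
  nilpotent_invariant_subspace (F := [set quot_op T | T in F]) (k := k) _ _ _ LQtriv.
- by move=> _ [T FT <-]; apply: bounded_quot_op; auto.
- move=> _ [T FT <-]; have [p p0 cp] := cF T FT; exists p => //.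
  rewrite quot_poly_op; auto; apply: compact_quot_op => //.
  by apply: compatible_poly_op; auto.
- move=> S /(lower_comm_quot compF)[T [FkT cT ->]] w.
  by rewrite -[w]proj_val quot_opE // Fk // proj0.
exists [set x | M x /\ W (proj x)]; split.
- apply/closed_nrmP => x Wx.
  have Mx : M x.
    apply: ((closed_nrmP M).1 (sq_closedM h)) => e.
    by move=> /Wx[y [My _] xy]; exists y.
  split=> //; apply: ((closed_nrmP W).1 cW) => e /Wx[y [My Wy] xy].
  exists (proj y) => //; rewrite -projB //; apply: le_lt_trans xy.
  by apply: nrm_proj_le; exact: linear_setB.
- split=> [|a x y [Mx Wx] [My Wy]].
    by split; [exact: lM.1|rewrite proj0; exact: lW.1].
  by split; auto; rewrite projD ?projZ; auto; apply: lW.2.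
- split=> [x Nx|x []//]; have Mx := sq_sub h Nx; split=> //.
  by rewrite (_ : proj x = 0); [exact: lW.1|exact/proj_eq0].
- split=> E.
    have WN x : M x /\ W (proj x) -> N x by move=> Wx; rewrite -E.
    move: u0; rewrite -[u]proj_val => /eqP; apply; apply/proj_eq0 => //.
    by apply: WN; rewrite proj_val.
  have [_] : [set x | M x /\ W (proj x)] (val v) by rewrite E; exact: valM.
  by rewrite proj_val.
- move=> T FT x [Mx Wx]; have [_ TM _] := compF T FT; split; first exact: TM.
  by rewrite -quot_opE; auto; apply: WS => //; exists T.
Qed.

End Subquotient.

(** * Maximal chains of invariant subspaces *)

Section Chains.
Context {R : realType} {X : completeNormedModType R[i]}.
Implicit Types (T : X -> X) (F : set (X -> X)) (C D : set (set X)) (L M N : set X).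

Lemma bounded_operatorW T : bounded_operator T -> bounded_op T.
Proof.
move=> [lT bT]; split=> //.
pose f : {linear X -> X} := HB.pack T (GRing.isLinear.Build _ X X *:%R T lT).
have /linear_boundedP : bounded_near f (nbhs (0 : X)) by [].
move=> /pinfty_ex_gt0[r r0 fr]; have rE : r = (complex.Re r)%:C.
  by rewrite RRe_real // gtr0_real.
exists (complex.Re r) => [|x]; first by rewrite -ler0c -rE ltW.
by have := fr x; rewrite /= !nrmE rE -rmorphM /= lecR.
Qed.

Lemma compact_operatorW T : compact_operator T -> compact_op T.
Proof.
move=> [[lT _] cT]; split=> //; exists (closure (T @` [set x | `|x| <= 1])) => // x x1.
by apply: subset_closure; exists x; rewrite //= nrmE lecR.
Qed.

Lemma poly_operatorE p T : poly_operator p T = poly_op p T.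
Proof. by apply/funext => x; rewrite /poly_operator fct_sumE. Qed.

Lemma iter_commutatorsE F k : iter_commutators F k = lower_comm F k.
Proof. by elim: k => //= k ->. Qed.

Lemma closed_subspaceP L : closed_subspace L <-> closed L /\ linear_set L.
Proof. by split=> [[]|[cL []]]. Qed.

Definition invariant_chain F C :=
  subspace_chain C /\ forall M, C M -> forall T, F T -> invariant_subspace T M.

Lemma ex_maximal_invariant_chain F : exists C, invariant_chain F C /\
  forall B, C `<` B -> ~ invariant_chain F B.
Proof.
apply: Zorn_bigcup => G GF Gtot; split; last first.
  by move=> M [C GC CM]; have [_] := GF _ GC; apply.
split; first by move=> M [C GC CM]; have [[+ _] _] := GF _ GC; apply.
move=> M M' [C GC CM] [C' GC' CM'].
have [CC'|C'C] := Gtot _ _ GC GC'.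
  by have [[_ tot] _] := GF _ GC'; apply: tot => //; exact: CC'.
by have [[_ tot] _] := GF _ GC; apply: tot => //; exact: C'C.
Qed.

(** Otherwise [L] could be added to the chain. *)
Lemma comparable_mem_maximal_chain F C L : invariant_chain F C ->
    (forall B, C `<` B -> ~ invariant_chain F B) -> closed_subspace L ->
    (forall T, F T -> invariant_subspace T L) ->
    (forall Z, C Z -> Z `<=` L \/ L `<=` Z) -> C L.
Proof.
move=> [[Csub Ctot] Cinv] Cmax Lsub Linv Lcmp; apply: contrapT => CL.
apply: (Cmax (C `|` [set L])).
  split; first by move=> Z; left.
  by move=> /(_ L) h; apply: CL; apply: h; right.
split; last by move=> M [/Cinv //|->].
split; first by move=> M [/Csub //|->].
move=> M M' [CM|->] [CM'|->].
- exact: Ctot.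
- exact: Lcmp.
- by have [?|?] := Lcmp _ CM'; [right|left].
- by left.
Qed.

End Chains.

Theorem theorem3p1 (R : realType) (X : completeNormedModType R[i])
    (F : set (X -> X))
    (F_polynomially_compact : forall T, F T -> polynomially_compact T)
    (F_L_nilpotent : L_nilpotent F) :
  triangularizable F.
Proof.
have bF T : F T -> bounded_op T.
  by move=> /F_polynomially_compact[/bounded_operatorW].
have cF T : F T -> exists2 p : {poly R[i]}, p != 0 & compact_op (poly_op p T).
  move=> /F_polynomially_compact[_ [p p0 /compact_operatorW cp]].
  by exists p => //; rewrite -poly_operatorE.
have [k] := F_L_nilpotent; rewrite iter_commutatorsE => Fk.
have {}Fk T : lower_comm F k T -> forall x, T x = 0 by rewrite Fk => ->.
have [C [Cinv Cmax]] := ex_maximal_invariant_chain F.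
have memC := comparable_mem_maximal_chain Cinv Cmax.
have [[Csub Ctot] CF] := Cinv.
exists C => //; split=> // D [Dsub Dtot] CD; apply/seteqP; split=> // L DL.
have Lsub := Dsub _ DL; have /closed_subspaceP[cL lL] := Lsub.
have Lcmp Z : C Z -> Z `<=` L \/ L `<=` Z by move=> /CD DZ; exact: Dtot.
have C0 : C [set x : X | x = 0].
  have z0 : linear_set [set x : X | x = 0] by apply: (linear_kernel (T := id)).
  apply: memC => [|T FT _ [x -> <-]|Z /Csub[_ Z0 _]].
  - by apply/closed_subspaceP; split=> //; exact: closed_kernel bounded_op_id.
  - by rewrite /= (lin0 (bF _ FT).1).
  - by right=> x ->.
(* [N] and [M] bound the gap of the chain [C] around [L] *)
pose U := [set x : X | exists Z, [/\ C Z, Z `<=` L & Z x]].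
pose N := closure U; pose M := [set x : X | forall Z, C Z -> L `<=` Z -> Z x].
have UL : U `<=` L by move=> x [Z [_ ZL Zx]]; exact: ZL.
have lU : linear_set U.
  split; first by exists [set x : X | x = 0]; split=> // x ->; exact: lL.1.
  move=> a x y [Z [CZ ZL Zx]] [Z' [CZ' Z'L Z'y]].
  have [ZZ'|Z'Z] := Ctot _ _ CZ CZ'.
    by exists Z'; split=> //; have [_ _] := Csub _ CZ'; apply=> //; exact: ZZ'.
  by exists Z; split=> //; have [_ _] := Csub _ CZ; apply=> //; exact: Z'Z.
have NL : N `<=` L by move=> x Nx; apply: cL; exact: closure_subset Nx.
have LM : L `<=` M by move=> x Lx Z CZ; apply.
have CN Z : C Z -> Z `<=` L -> Z `<=` N.
  by move=> CZ ZL x Zx; apply: subset_closure; exists Z.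
have NF T : F T -> stable_set T N.
  move=> FT; apply: closure_stable; first exact: bF.
  move=> x [Z [CZ ZL Zx]]; exists Z; split=> //.
  by apply: (CF _ CZ _ FT); exists x.
have MF T : F T -> stable_set T M.
  by move=> FT x Mx Z CZ LZ; apply: (CF _ CZ _ FT); exists x => //; exact: Mx.
have sqMN : subquotient M N.
  split.
  - have -> : M = \bigcap_(Z in [set Z | C Z /\ L `<=` Z]) Z.
      by apply/seteqP; split=> x Mx Z => [[CZ LZ]|CZ LZ]; apply: Mx.
    by apply: closed_bigI => Z [/Csub[]].
  - split=> [Z CZ LZ|a x y Mx My Z CZ LZ]; first exact: LZ lL.1.
    by have [_ _ ZD] := Csub _ CZ; apply: ZD; [exact: Mx|exact: My].
  - exact: closed_closure.
  - exact: closure_linear_set.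
  - exact: subset_trans NL LM.
have stable_inv T Z : stable_set T Z -> invariant_subspace T Z.
  by move=> TZ _ [x Zx <-]; exact: TZ.
have [LN|LN] := pselect (L = N).
  by apply: memC => // T FT; apply: stable_inv; rewrite LN; exact: NF.
have [LM'|LM'] := pselect (L = M).
  by apply: memC => // T FT; apply: stable_inv; rewrite LM'; exact: MF.
have compF T : F T -> compatible_op (M := M) (N := N) T.
  by move=> FT; split; [exact: (bF _ FT).1|exact: MF|exact: NF].
have [W [cW lW [NW WM] [WN0 WM0] WF]] :=
  subquotient_invariant_subspace sqMN compF bF cF Fk cL lL NL LM LN LM'.
have CW : C W.
  apply: memC => [|T FT|Z CZ].
  - by apply/closed_subspaceP.
  - by apply: stable_inv; exact: WF.
  have [ZL|LZ] := Lcmp _ CZ; first by left; apply: subset_trans NW; exact: CN.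
  by right=> x /WM; apply.
exfalso; have [WL|LW] := Lcmp _ CW.
  by apply: WN0; apply/seteqP; split=> //; exact: CN.
by apply: WM0; apply/seteqP; split=> // x; apply.
Qed.
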